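(* Let $d,p\ge 1$ be integers, $\mathcal P=(\mathbf x_1,\dots,\mathbf x_p)$ points of $\mathbb R^d$, and let $(\mathbf X_i)_{i\in\mathbb N}$ be $\mathbb R^d$-valued random vectors with $\mathbf Y_i=(\mathbf 1(\mathbf X_i\le \mathbf x_1),\dots,\mathbf 1(\mathbf X_i\le \mathbf x_p))$ (inequalities componentwise). Suppose there is a probability space on which: (a) $(\mathbf Y_i)_{i\in\mathbb N}$ is a $p$-dimensional stationary time series whose long-run covariance matrix $$\Sigma=\mathrm{Cov}(\mathbf Y_1,\mathbf Y_1)+\sum_{i\ge 2}\{\mathrm{Cov}(\mathbf Y_1,\mathbf Y_i)+\mathrm{Cov}(\mathbf Y_i,\mathbf Y_1)\}$$ exists and is positive definite; (b) for each $m\in\mathbb N$, $\mathbf W_{1,m}$ and $\mathbf W_{2,m}$ are two independent $p$-dimensional standard Brownian motions; and (c) for some $0<\xi<\tfrac12$, $$\sup_{k>m}\frac{1}{(k-m)^\xi}\Big\|\sum_{i=m+1}^k\{\mathbf Y_i-\mathbb E(\mathbf Y_1)\}-\Sigma^{1/2}\mathbf W_{1,m}(k-m)\Big\|_2=O_{\mathbb P}(1),\quad \frac{1}{m^\xi}\Big\|\sum_{i=1}^m\{\mathbf Y_i-\mathbb E(\mathbf Y_1)\}-\Sigma^{1/2}\mathbf W_{2,m}(m)\Big\|_2=O_{\mathbb P}(1)$$ as $m\to\infty$. Let $\Sigma_m$ be $p\times p$ random matrices (estimators of $\Sigma$ based on $\mathbf Y_1,\dots,\mathbf Y_m$, assumed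 invertible) with $\Sigma_m\to\Sigma$ in probability, and define for $k\ge m+1$ $$D_m(k)=\max_{j\in\{m,\dots,k-1\}}\frac{j(k-j)}{m^{3/2}}\big\|\bar{\mathbf Y}_{1:j}-\bar{\mathbf Y}_{j+1:k}\big\|_{\Sigma_m^{-1}}.$$ Fix $\eta>0$. Then, as $m\to\infty$, $$\sup_{k>m}(m/k)^{\frac32+\eta}D_m(k)\ \leadsto\ \mathcal L_{p,\eta}=\sup_{1\le s\le t<\infty}t^{-\frac32-\eta}\|t\mathbf W(s)-s\mathbf W(t)\|_{I_p},$$ where $\mathbf W$ is a $p$-dimensional standard Brownian motion (the supremum on the left is over integers $k$, the one on the right over reals $s,t$). Moreover, $\mathcal L_{p,\eta}$ is almost surely finite.
   Context: For integers $1\le j\le k$, $\bar{\mathbf Y}_{j:k}=\frac{1}{k-j+1}\sum_{i=j}^k\mathbf Y_i$. For a $p\times p$ positive-definite matrix $M$ and $\mathbf y\in\mathbb R^p$, $\|\mathbf y\|_M=\sqrt{(\mathbf y^\top M\mathbf y)/p}$; $I_p$ is the $p\times p$ identity matrix; $\|\cdot\|_2$ is the Euclidean norm; $\Sigma^{1/2}$ is the symmetric positive-definite square root. $\leadsto$ denotes convergence in distribution. *)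

(* Defs.v *)
From HB Require Import structures.
From mathcomp Require Import all_boot all_order all_algebra.
From mathcomp Require Import all_classical all_reals all_analysis.
Set Implicit Arguments. Unset Strict Implicit. Unset Printing Implicit Defensive.
Import Order.TTheory GRing.Theory Num.Theory.
Import numFieldNormedType.Exports.
Local Open Scope classical_set_scope.
Local Open Scope ring_scope.

Section Defs.
Context {R : realType} {dT : measure_display} {T : measurableType dT}.

Definition mutually_indep (P : probability T R) (I : finType) (Z : I -> T -> R) :=
  forall B : I -> set R, (forall i, measurable (B i)) ->
    P (\bigcap_(i in [set: I]) (Z i @^-1` B i)) =
    (\prod_(i : I) P (Z i @^-1` B i))%E.

Definition cyl_event {p : nat} (W : R -> T -> 'cV[R]_p) (n : nat)
   (ts : 'I_n -> R) (js : 'I_n -> 'I_p) (B : 'I_n -> set R) : set T :=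
  \bigcap_(k in [set: 'I_n]) [set w | B k (W (ts k) w (js k) ord0)].

Definition std_BM (P : probability T R) {p : nat} (W : R -> T -> 'cV[R]_p) :=
  [/\ (forall t (j : 'I_p), measurable_fun setT (fun w => W t w j ord0)),
      (forall w, W 0 w = 0),
      (forall w (j : 'I_p),
          {within [set t : R | 0 <= t], continuous (fun t => W t w j ord0)}) &
      (forall (n : nat) (ts : 'I_n.+1 -> R),
          0 <= ts ord0 ->
          (forall k : 'I_n, ts (widen_ord (leqnSn n) k) < ts (lift ord0 k)) ->
          let Z := fun (kj : 'I_n * 'I_p) w =>
             W (ts (lift ord0 kj.1)) w kj.2 ord0
             - W (ts (widen_ord (leqnSn n) kj.1)) w kj.2 ord0 in
          mutually_indep P Z /\
          forall kj B, measurable B ->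
            P (Z kj @^-1` B) =
            normal_prob 0 (Num.sqrt (ts (lift ord0 kj.1)
                                     - ts (widen_ord (leqnSn n) kj.1))) B)].

(* independence of two processes (of their generated sigma-algebras) *)
Definition indep_processes (P : probability T R) {p : nat}
    (W1 W2 : R -> T -> 'cV[R]_p) :=
  forall n1 n2 (t1 : 'I_n1 -> R) (j1 : 'I_n1 -> 'I_p) (B1 : 'I_n1 -> set R)
    (t2 : 'I_n2 -> R) (j2 : 'I_n2 -> 'I_p) (B2 : 'I_n2 -> set R),
    (forall k, measurable (B1 k)) -> (forall k, measurable (B2 k)) ->
    P (cyl_event W1 t1 j1 B1 `&` cyl_event W2 t2 j2 B2) =
    (P (cyl_event W1 t1 j1 B1) * P (cyl_event W2 t2 j2 B2))%E.

Definition bounded_in_prob (P : probability T R) (Z : nat -> T -> \bar R) :=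
  forall eps : R, 0 < eps -> exists M : R,
    \forall m \near \oo, (P [set w | (M%:E < Z m w)%E] < eps%:E)%E.

End Defs.

Definition norm2 {R : realType} {p : nat} (y : 'cV[R]_p) : R :=
  Num.sqrt (\sum_(i < p) y i ord0 ^+ 2).
Definition normM {R : realType} {p : nat} (M : 'M[R]_p) (y : 'cV[R]_p) : R :=
  Num.sqrt (((y^T *m M *m y) ord0 ord0) / p%:R).

Definition posdef {R : realType} {p : nat} (M : 'M[R]_p) :=
  M^T = M /\ forall v : 'cV[R]_p, v != 0 -> 0 < (v^T *m M *m v) ord0 ord0.

Definition Yvec {R : realType} {T : Type} {d p : nat} (xs : 'I_p -> 'cV[R]_d)
    (X : nat -> T -> 'cV[R]_d) (i : nat) (w : T) : 'cV[R]_p :=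
  \col_(j < p) (if [forall l : 'I_d, X i w l ord0 <= xs j l ord0] then 1 else 0).

Definition Ybar {R : realType} {T : Type} {p : nat} (Y : nat -> T -> 'cV[R]_p)
    (j k : nat) (w : T) : 'cV[R]_p :=
  (k - j + 1)%:R^-1 *: \sum_(j <= i < k.+1) Y i w.

Definition Dmk {R : realType} {T : Type} {p : nat} (Y : nat -> T -> 'cV[R]_p)
    (Sm : nat -> T -> 'M[R]_p) (m k : nat) (w : T) : R :=
  \big[Num.max/0]_(m <= j < k)
     ((j * (k - j))%:R / powR m%:R (3 / 2) *
        normM (invmx (Sm m w)) (Ybar Y 1 j w - Ybar Y j.+1 k w)).

Definition monitor_stat {R : realType} {T : Type} {p : nat}
    (Y : nat -> T -> 'cV[R]_p) (Sm : nat -> T -> 'M[R]_p) (eta : R)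
    (m : nat) (w : T) : \bar R :=
  ereal_sup [set (powR (m%:R / k%:R) (3 / 2 + eta) * Dmk Y Sm m k w)%:E
            | k in [set k : nat | (m < k)%N]].

Definition Lpeta {R : realType} {T : Type} {p : nat} (W : R -> T -> 'cV[R]_p)
    (eta : R) (w : T) : \bar R :=
  ereal_sup [set x | exists s t : R, 1 <= s <= t /\
     x = (powR t (- (3 / 2) - eta) * normM 1%:M (t *: W s w - s *: W t w))%:E].

Definition meanY {R : realType} {dT : measure_display} {T : measurableType dT}
    (P : probability T R) {p : nat} (Y : nat -> T -> 'cV[R]_p) : 'cV[R]_p :=
  \col_(a < p) fine (expectation P (fun w => Y 1%N w a ord0)).

Definition covY {R : realType} {dT : measure_display} {T : measurableType dT}
    (P : probability T R) {p : nat} (Y : nat -> T -> 'cV[R]_p) (i j : nat)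
    (a b : 'I_p) : R :=
  fine (expectation P (fun w => Y i w a ord0 * Y j w b ord0))
  - fine (expectation P (fun w => Y i w a ord0)) * fine (expectation P (fun w => Y j w b ord0)).

(* strict stationarity of a sequence (Y_i)_{i>=1} of {0,1}^p-valued vectors,
   via its finite-dimensional distributions *)
Definition stationary {R : realType} {dT : measure_display} {T : measurableType dT}
    (P : probability T R) {p : nat} (Y : nat -> T -> 'cV[R]_p) :=
  forall (n h : nat) (ys : 'I_n -> 'cV[R]_p),
    P [set w | forall k : 'I_n, Y (k + h).+1 w = ys k] =
    P [set w | forall k : 'I_n, Y k.+1 w = ys k].

Definition long_run_cov {R : realType} {dT : measure_display} {T : measurableType dT}
    (P : probability T R) {p : nat} (Y : nat -> T -> 'cV[R]_p) (Sigma : 'M[R]_p) :=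
  forall a b : 'I_p,
    (fun n : nat => covY P Y 1 1 a b
        + \sum_(2 <= i < n) (covY P Y 1 i a b + covY P Y i 1 a b))
      @ \oo --> Sigma a b.

(* Main.v *)
(* With S_j the centred partial sums, j(k-j)(Ybar_{1:j} - Ybar_{j+1:k}) equals
   k S_j - j S_k.  By (c), S_j is Sigma^{1/2} B_m(j) up to O_P(j^xi), where
   B_m(j) = W_{2,m}(m) + W_{1,m}(j-m); after weighting, the error is O_P(m^{xi-1/2})
   uniformly in m <= j < k, and replacing Sigma by Sigma_m costs a factor 1 + o_P(1).
   The increments of B_m on the integers >= m are those of a Brownian motion, so by
   scaling the approximating supremum has the law of the supremum of the limiting
   functional of W restricted to the grid of mesh 1/m.  By continuity of paths these
   grid suprema converge pointwise to L_{p,eta} from below; no tightness is needed.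
   Finiteness follows from a chaining bound |W(t)| = O(t^{1/2+eta}) on the dyadic
   blocks [0, 2^n], which only uses the Gaussian tails of single increments. *)

Require Import Defs.
From HB Require Import structures.
From mathcomp Require Import all_boot all_order all_algebra.
From mathcomp Require Import all_classical all_reals all_analysis.
From mathcomp Require Import measurable_realfun.
From mathcomp Require Import ring lra.
Set Implicit Arguments.
Unset Strict Implicit.
Unset Printing Implicit Defensive.
Import Order.TTheory GRing.Theory Num.Theory.
Import numFieldNormedType.Exports.
Local Open Scope classical_set_scope.
Local Open Scope ring_scope.

(** The approximating motions live on [T] and change with m, while the limit lives on [T'], so no
    path of one can be compared with a path of the other. The transfer goes through laws only:
    rectangles of finitely many increments, then a pi-lambda argument, then continuity from above up
    to the countable event that the grid supremum is at most y. The event [Lpeta <= y] lies in every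
    grid event and equals their limsup. This gives its measurability although the supremum is
    uncountable, and it squeezes the grid probabilities between P'(L <= y) and the probabilities of
    decreasing unions, so they converge at every y. Continuity of the limiting distribution function
    at x is spent on absorbing the factors 1 - r, 1 + r and the additive error of the pathwise
    comparison. The estimators are arbitrary functions of the data; they are measurable because
    vectors of indicators take finitely many values. *)

(** * Scaling and tails of centred normal laws *)

Lemma lebesgue_measure_scale (R : realType) (c : R) (A : set R) : 0 < c ->
  measurable A ->
  pushforward lebesgue_measure
    ( *%R c : measurableTypeR R -> measurableTypeR R) A =
  (c^-1%:E * lebesgue_measure A)%E.
Proof.
move=> c0 mA.
pose nu := pushforward lebesgue_measure
    ( *%R c : measurableTypeR R -> measurableTypeR R).
(* Turned around, the claim follows from uniqueness: [c * nu] gives half-open intervals their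
   length. *)
suff -> : lebesgue_measure A = (c%:E * nu A)%E.
  by rewrite muleA -EFinM mulVf ?mul1e// gt_eqF.
have mc : measurable_fun setT ( *%R c : measurableTypeR R -> measurableTypeR R).
  by apply: measurable_funM => //; exact: measurable_cst.
pose mm := isMeasurableFun.Build _ _ _ _ _ mc.
pose phi : {mfun measurableTypeR R >-> measurableTypeR R} := HB.pack ( *%R c) mm.
have := @lebesgue_measure_unique R (mscale (NngNum (ltW c0)) (pushforward lebesgue_measure phi)).
apply => // _ [[a b]] _ <-.
have E : ( *%R c) @^-1` `]a, b]%classic = `](a / c), (b / c)]%classic.
  by apply/seteqP; split => x /=; rewrite !in_itv /= ltr_pdivrMr// ler_pdivlMr//
    (mulrC x).
transitivity (c%:E * lebesgue_measure `](a / c)%R, (b / c)%R]%classic)%E; last first.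
  by rewrite -E.
rewrite !lebesgue_measure_itv /= !lte_fin ltr_pM2r ?invr_gt0//.
case: ifP => _; last by rewrite mule0.
rewrite -!EFinD -EFinM; congr EFin; rewrite -mulrBl mulrC divfK// gt_eqF//.
Qed.

Lemma normal_pdf_scale (R : realType) (c s x : R) : 0 < c -> s != 0 ->
  normal_pdf 0 s (x / c) = c * normal_pdf 0 (c * s) x.
Proof.
move=> c0 s0; have c0' : c != 0 by rewrite gt_eqF.
rewrite !normal_pdfE ?mulf_neq0// /normal_peak /normal_fun mulrA; congr (_ * expR _).
  have -> : (c * s) ^+ 2 * pi *+ 2 = c ^+ 2 * (s ^+ 2 * pi *+ 2).
    by rewrite exprMn -mulrA mulrnAr.
  rewrite sqrtrM ?sqr_ge0// sqrtr_sqr gtr0_norm//.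
  by rewrite invfM mulrA divff// mul1r.
by rewrite !subr0; field; rewrite c0' s0.
Qed.

(** Change of variables; with [c = sqrt m] it turns a Brownian increment over a time step [1/m] into
    one of unit variance. *)
Lemma normal_prob_scale (R : realType) (c s : R) (B : set R) : 0 < c -> s != 0 ->
  measurable B ->
  normal_prob 0 s (( *%R c) @^-1` B) = normal_prob 0 (c * s) B.
Proof.
move=> c0 s0 mB.
have mc : measurable_fun setT ( *%R c : measurableTypeR R -> measurableTypeR R).
  by apply: measurable_funM => //; exact: measurable_cst.
pose mm := isMeasurableFun.Build _ _ _ _ _ mc.
pose phi : {mfun measurableTypeR R >-> measurableTypeR R} := HB.pack ( *%R c) mm.
have ic0 : 0 <= c^-1 by rewrite invr_ge0 ltW.
rewrite /normal_prob.
have mg : measurable_fun B (fun x : measurableTypeR R => (c * normal_pdf 0 (c * s) x)%:E).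
  apply/measurable_funTS/measurable_EFinP/measurable_funM => //.
  exact: measurable_normal_pdf.
transitivity (\int[pushforward lebesgue_measure phi]_(x in B)
    (c * normal_pdf 0 (c * s) x)%:E)%E.
  rewrite ge0_integral_pushforward//; last first.
    by move=> y _; rewrite lee_fin mulr_ge0 ?normal_pdf_ge0 ?ltW.
  apply: eq_integral => x _ /=; rewrite -normal_pdf_scale// mulrAC divff ?mul1r// gt_eqF//.
rewrite (@eq_measure_integral _ _ _ _ (mscale (NngNum ic0) lebesgue_measure)); last first.
  by move=> A mA _; exact: lebesgue_measure_scale.
rewrite ge0_integral_mscale//; last first.
  by move=> y _; rewrite lee_fin mulr_ge0 ?normal_pdf_ge0 ?ltW.
under eq_integral do rewrite EFinM.
rewrite ge0_integralZl//=.
- by rewrite muleA -EFinM mulVf ?mul1e// gt_eqF.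
- by apply/measurable_funTS/measurable_EFinP; exact: measurable_normal_pdf.
- by move=> y _; rewrite lee_fin normal_pdf_ge0.
- by rewrite lee_fin ltW.
Qed.

(* On [x <= |y|] one has [exp(-y^2/2s^2) <= exp(-x^2/4s^2) exp(-y^2/4s^2)], and the
   last factor is the unnormalised density of variance [2s^2]. *)
Lemma normal_prob_tail (R : realType) (s x : R) : 0 < s -> 0 <= x ->
  (normal_prob 0 s [set y : R | (x < `|y|)%R] <=
     (2 * expR (- (x ^+ 2 / (4 * s ^+ 2))))%:E)%E.
Proof.
move=> s0 x0.
have s0' : s != 0 by rewrite gt_eqF.
pose c : R := Num.sqrt 2.
have c0 : 0 < c by rewrite sqrtr_gt0.
have c0' : c != 0 by rewrite gt_eqF.
have c2 : c ^+ 2 = 2 by rewrite sqr_sqrtr.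
have cle : c <= 2 by rewrite -(@ler_pXn2r _ 2)// ?nnegrE ?ltW// c2; lra.
pose e := expR (- (x ^+ 2 / (4 * s ^+ 2))).
pose D := [set y : R | x < `|y|].
have mD : measurable D.
  rewrite -[X in measurable X]setTI.
  exact: (measurable_fun_ltr (measurable_cst x) (@normr_measurable _ _)).
rewrite -/D.
apply: (@le_trans _ _ (\int[lebesgue_measure]_(y in D) ((2 * e) * normal_pdf 0 (c * s) y)%:E)%E).
  apply: ge0_le_integral => //=.
  - by move=> y _; rewrite lee_fin normal_pdf_ge0.
  - by apply/measurable_funTS/measurable_EFinP; exact: measurable_normal_pdf.
  - by apply/measurable_funTS/measurable_EFinP/measurable_funM => //; exact: measurable_normal_pdf.
  move=> y /= xy; rewrite lee_fin.
  have -> : normal_pdf 0 s y = c * (normal_peak (c * s) * expR (- (y ^+ 2 / (2 * s ^+ 2)))).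
    rewrite -[in LHS](mul1r y) -(@divff _ c)// mulrAC normal_pdf_scale//.
    rewrite normal_pdfE ?mulf_neq0// /normal_fun; congr (_ * (_ * expR _)).
    rewrite subr0 mulNr; congr (- _); rewrite !exprMn c2; field.
    by rewrite ?c0' s0'.
  rewrite normal_pdfE ?mulf_neq0// /normal_fun subr0.
  rewrite (_ : 2 * e * _ = 2 * (normal_peak (c * s) *
    (e * expR (- y ^+ 2 / ((c * s) ^+ 2 *+ 2))))); last by ring.
  apply: ler_pM => //; first exact: ltW.
    by rewrite mulr_ge0 ?normal_peak_ge0 ?expR_ge0.
  rewrite ler_wpM2l ?normal_peak_ge0//.
  rewrite -expRD ler_expR exprMn c2.
  have -> : - y ^+ 2 / (2 * s ^+ 2 *+ 2) = - (y ^+ 2 / (4 * s ^+ 2)).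
    by field; rewrite s0'.
  rewrite -opprD lerN2 -mulrDl.
  have -> : y ^+ 2 / (2 * s ^+ 2) = (y ^+ 2 + y ^+ 2) / (4 * s ^+ 2).
    by field; rewrite s0'.
  rewrite ler_pM2r ?invr_gt0 ?mulr_gt0 ?exprn_gt0// lerD2r.
  by rewrite -(real_normK (num_real y)) lerXn2r// ?nnegrE// ltW.
apply: (@le_trans _ _ (\int[lebesgue_measure]_y ((2 * e) * normal_pdf 0 (c * s) y)%:E)%E).
  apply: ge0_subset_integral => //=.
  - by apply/measurable_EFinP/measurable_funM => //; exact: measurable_normal_pdf.
  - by move=> y _; rewrite lee_fin mulr_ge0 ?normal_pdf_ge0// mulr_ge0 ?expR_ge0.
under eq_integral do rewrite EFinM.
rewrite ge0_integralZl//=.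
- by rewrite integral_normal_pdf mule1.
- by apply/measurable_EFinP; exact: measurable_normal_pdf.
- by move=> y _; rewrite lee_fin normal_pdf_ge0.
- by rewrite lee_fin mulr_ge0 ?expR_ge0.
Qed.

(** * Laws of finite families of real random variables *)

Section FiniteFamilies.
Context {R : realType} (I : finType).

Definition rectangles : set (set (I -> R)) :=
  [set A | exists2 B : I -> set R, (forall i, measurable (B i)) &
    A = [set x | forall i, B i (x i)]].

Lemma setI_closed_rectangles : setI_closed rectangles.
Proof.
move=> _ _ [B mB ->] [C mC ->]; exists (fun i => B i `&` C i).
  by move=> i; exact: measurableI.
apply/seteqP; split => x /=; first by case=> xB xC i; split.
by move=> xBC; split=> i; have [] := xBC i.
Qed.

Lemma measurable_coord (i : I) :
  measurable_fun setT (fun x : g_sigma_algebraType rectangles => x i : R).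
Proof.
move=> _ B mB; rewrite setTI; apply: sub_sigma_algebra.
exists (fun k => if k == i then B else setT).
  by move=> k; case: ifP.
apply/seteqP; split => x /=.
  by move=> Bxi k; case: eqVneq => // ->.
by move/(_ i); rewrite eqxx.
Qed.

Lemma measurable_family d (T : measurableType d) (Z : I -> T -> R) :
  (forall i, measurable_fun setT (Z i)) ->
  measurable_fun setT (fun w => (fun i => Z i w) : g_sigma_algebraType rectangles).
Proof.
move=> mZ; apply: (@measurability _ _ T (g_sigma_algebraType rectangles) setT _ rectangles erefl).
move=> _ [_ [B mB ->] <-]; rewrite setTI.
rewrite (_ : _ @^-1` _ = \bigcap_(i in [set: I]) (Z i @^-1` B i)).
  apply: fin_bigcap_measurable => // i _.
  by rewrite -[X in measurable X]setTI; exact: mZ.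
by apply/seteqP; split => w /= H i; [move=> _; exact: H|exact: H].
Qed.

(** The pi-lambda theorem. It is stated for measures rather than probabilities because it is also
    applied to [P] restricted to an event and to a multiple of [P]. *)
Lemma rectangles_law_unique d (T : measurableType d) d' (T' : measurableType d')
    (mu : {measure set T -> \bar R}) (mu' : {measure set T' -> \bar R})
    (Z : I -> T -> R) (Z' : I -> T' -> R) :
  (forall i, measurable_fun setT (Z i)) ->
  (forall i, measurable_fun setT (Z' i)) ->
  (mu setT < +oo)%E ->
  (forall B : I -> set R, (forall i, measurable (B i)) ->
    mu [set w | forall i, B i (Z i w)] = mu' [set w | forall i, B i (Z' i w)]) ->
  forall A : set (g_sigma_algebraType rectangles), measurable A ->
    mu ((fun w i => Z i w) @^-1` A) = mu' ((fun w i => Z' i w) @^-1` A).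
Proof.
move=> mZ mZ' muoo H A mA.
have mF := measurable_family mZ; have mF' := measurable_family mZ'.
pose F : {mfun T >-> g_sigma_algebraType rectangles} :=
  HB.pack (fun w => (fun i => Z i w) : g_sigma_algebraType rectangles)
    (isMeasurableFun.Build _ _ _ _ _ mF).
pose F' : {mfun T' >-> g_sigma_algebraType rectangles} :=
  HB.pack (fun w => (fun i => Z' i w) : g_sigma_algebraType rectangles)
    (isMeasurableFun.Build _ _ _ _ _ mF').
have := @measure_unique _ R (g_sigma_algebraType rectangles) rectangles
  (fun=> setT) erefl setI_closed_rectangles _ _ (pushforward mu F) (pushforward mu' F').
apply => //.
- by move=> _; exists (fun=> setT) => //; apply/seteqP; split.
- by rewrite bigcup_const.
- by move=> _ [B mB ->]; exact: H.
Qed.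

End FiniteFamilies.

(** * Euclidean norm, Frobenius bound, and perturbation of the weight matrix *)

Section EuclideanNorm.
Context {R : realType}.

Definition dotv p (x y : 'cV[R]_p) : R := \sum_(i < p) x i ord0 * y i ord0.

Lemma mulmx_dotv p (x y : 'cV[R]_p) : (x^T *m y) ord0 ord0 = dotv x y.
Proof. by rewrite mxE; apply: eq_bigr => i _; rewrite mxE. Qed.

Lemma dotvDl p (x y z : 'cV[R]_p) : dotv (x + y) z = dotv x z + dotv y z.
Proof. by rewrite -big_split; apply: eq_bigr => i _; rewrite mxE mulrDl. Qed.

Lemma dotvC p (x y : 'cV[R]_p) : dotv x y = dotv y x.
Proof. by apply: eq_bigr => i _; rewrite mulrC. Qed.

Lemma dotvv_ge0 p (x : 'cV[R]_p) : 0 <= dotv x x.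
Proof. by apply: sumr_ge0 => i _; rewrite -expr2 sqr_ge0. Qed.

Lemma norm2E p (x : 'cV[R]_p) : norm2 x = Num.sqrt (dotv x x).
Proof. by congr Num.sqrt; apply: eq_bigr => i _; rewrite expr2. Qed.

Lemma norm2_ge0 p (x : 'cV[R]_p) : 0 <= norm2 x.
Proof. exact: sqrtr_ge0. Qed.

Lemma sqr_norm2 p (x : 'cV[R]_p) : norm2 x ^+ 2 = dotv x x.
Proof. by rewrite norm2E sqr_sqrtr// dotvv_ge0. Qed.

Lemma norm2Z p (c : R) (x : 'cV[R]_p) : norm2 (c *: x) = `|c| * norm2 x.
Proof.
rewrite /norm2 (eq_bigr (fun i => c ^+ 2 * x i ord0 ^+ 2)); last first.
  by move=> i _; rewrite mxE exprMn.
by rewrite -mulr_sumr sqrtrM ?sqr_ge0// sqrtr_sqr.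
Qed.

Lemma norm2N p (x : 'cV[R]_p) : norm2 (- x) = norm2 x.
Proof. by rewrite -scaleN1r norm2Z normrN1 mul1r. Qed.

Lemma sqr_dotv_le p (x y : 'cV[R]_p) : dotv x y ^+ 2 <= dotv x x * dotv y y.
Proof.
have [y0|y0] := eqVneq (dotv y y) 0.
  have yi i : y i ord0 = 0.
    have /psumr_eq0P H := y0; apply/eqP; rewrite -sqrf_eq0 expr2; apply/eqP.
    by apply: H => // j _; rewrite -expr2 sqr_ge0.
  by rewrite [dotv x y]big1 ?expr0n ?y0 ?mulr0// => i _; rewrite yi mulr0.
have yp : 0 < dotv y y by rewrite lt_neqAle eq_sym y0 dotvv_ge0.
rewrite -subr_ge0 -(pmulr_rge0 _ yp).
(* This square expands to [dotv y y] times the difference of the two sides of Cauchy-Schwarz. *)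
have : 0 <= dotv (dotv y y *: x - dotv x y *: y) (dotv y y *: x - dotv x y *: y).
  exact: dotvv_ge0.
congr (0 <= _); rewrite {1}/dotv.
under eq_bigr => i _.
  rewrite !mxE.
  rewrite (_ : _ * _ = dotv y y ^+ 2 * (x i ord0 * x i ord0) -
    (2 * dotv y y * dotv x y) * (x i ord0 * y i ord0) +
    dotv x y ^+ 2 * (y i ord0 * y i ord0)); last by ring.
  over.
rewrite big_split/= sumrB -!mulr_sumr -/(dotv x x) -/(dotv x y) -/(dotv y y).
ring.
Qed.

Lemma normr_dotv_le p (x y : 'cV[R]_p) : `|dotv x y| <= norm2 x * norm2 y.
Proof.
rewrite -sqrtr_sqr !norm2E -sqrtrM ?dotvv_ge0// ler_wsqrtr//.
exact: sqr_dotv_le.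
Qed.

Lemma norm2D p (x y : 'cV[R]_p) : norm2 (x + y) <= norm2 x + norm2 y.
Proof.
rewrite -(@ler_pXn2r _ 2)// ?nnegrE ?norm2_ge0 ?addr_ge0 ?norm2_ge0//.
rewrite sqrrD !sqr_norm2 dotvDl !(dotvC _ (x + y)) !dotvDl (dotvC y x).
have := le_trans (ler_norm _) (normr_dotv_le x y); rewrite mulr2n; lra.
Qed.

Lemma norm2B p (x y : 'cV[R]_p) : norm2 (x - y) <= norm2 x + norm2 y.
Proof. by rewrite -(norm2N y) norm2D. Qed.

Lemma ler_norm2B p (x y : 'cV[R]_p) : norm2 x - norm2 y <= norm2 (x + y).
Proof. by rewrite lerBlDr -{1}(addrK y x) norm2B. Qed.

Definition frob m n (A : 'M[R]_(m, n)) : R :=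
  Num.sqrt (\sum_i \sum_j A i j ^+ 2).

Lemma frob_ge0 m n (A : 'M[R]_(m, n)) : 0 <= frob A.
Proof. exact: sqrtr_ge0. Qed.

Lemma norm2_mulmx m n (A : 'M[R]_(m, n)) (x : 'cV[R]_n) :
  norm2 (A *m x) <= frob A * norm2 x.
Proof.
rewrite norm2E [norm2 x]norm2E -sqrtrM; last first.
  by apply: sumr_ge0 => i _; apply: sumr_ge0 => j _; exact: sqr_ge0.
rewrite ler_wsqrtr// mulr_suml; apply: ler_sum => i _; rewrite -expr2.
have := sqr_dotv_le (row i A)^T x; congr (_ ^+ 2 <= _ * _).
  by rewrite mxE; apply: eq_bigr => j _; rewrite !mxE.
by apply: eq_bigr => j _; rewrite !mxE expr2.
Qed.

Lemma frob_le n (A : 'M[R]_n) (d : R) : 0 <= d ->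
  (forall i j, `|A i j| <= d) -> frob A <= n%:R * d.
Proof.
move=> d0 Ad; rewrite -[leRHS]ger0_norm ?mulr_ge0// -sqrtr_sqr ler_wsqrtr//.
rewrite (@le_trans _ _ (\sum_(i < n) \sum_(j < n) d ^+ 2))//.
  apply: ler_sum => i _; apply: ler_sum => j _.
  by rewrite -real_normK ?num_real// lerXn2r ?nnegrE.
by rewrite !sumr_const !card_ord exprMn (expr2 n%:R) -mulrA !mulr_natl.
Qed.

Lemma normME p (M : 'M[R]_p) (y : 'cV[R]_p) :
  normM M y = Num.sqrt (dotv y (M *m y)) / Num.sqrt p%:R.
Proof.
rewrite /normM -mulmxA mulmx_dotv mulrC sqrtrM ?invr_ge0//.
by rewrite sqrtrV ?ler0n// mulrC.
Qed.

Lemma normM1E p (y : 'cV[R]_p) : normM 1%:M y = norm2 y / Num.sqrt p%:R.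
Proof. by rewrite normME mul1mx -norm2E. Qed.

Lemma normMZ p (M : 'M[R]_p) (c : R) (y : 'cV[R]_p) :
  normM M (c *: y) = `|c| * normM M y.
Proof.
rewrite !normME -scalemxAr mulrA; congr (_ / _).
rewrite (_ : dotv _ _ = c ^+ 2 * dotv y (M *m y)); last first.
  by rewrite mulr_sumr; apply: eq_bigr => i _; rewrite !mxE; ring.
by rewrite sqrtrM ?sqr_ge0// sqrtr_sqr.
Qed.

Lemma normM_ge0 p (M : 'M[R]_p) (y : 'cV[R]_p) : 0 <= normM M y.
Proof. exact: sqrtr_ge0. Qed.

Lemma posdef_unitmx p (M : 'M[R]_p) : posdef M -> M \in unitmx.
Proof.
move=> [_ Mp]; rewrite unitmxE unitfE; apply/det0P => -[v v0 vM].
have := Mp v^T; rewrite trmx_eq0 trmxK => /(_ v0).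
by rewrite vM mul0mx mxE ltxx.
Qed.

(* Both [<u, z>] and [|u|^2] agree with [|z|^2] up to a factor [1 + O(e)]. *)
Lemma perturbed_quadratic p (f z u : 'cV[R]_p) (e : R) :
  0 < e <= 1 / 4 -> norm2 f <= e * norm2 z -> u = z + f ->
  (1 - 4 * e) * norm2 u <= Num.sqrt (dotv u z) <= (1 + 4 * e) * norm2 u.
Proof.
move=> /andP[e0 e4] Fz uE.
have z0 := norm2_ge0 z; have u0 := norm2_ge0 u.
have uz : norm2 u <= (1 + e) * norm2 z.
  by rewrite uE (le_trans (norm2D _ _))// mulrDl mul1r lerD2l.
have zu : (1 - e) * norm2 z <= norm2 u.
  rewrite uE (le_trans _ (ler_norm2B _ _))//; lra.
have dot : `|dotv u z - norm2 z ^+ 2| <= e * norm2 z ^+ 2.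
  rewrite uE dotvDl sqr_norm2 addrC addKr -sqr_norm2 expr2 mulrA.
  by rewrite (le_trans (normr_dotv_le _ _))// ler_wpM2r.
move: dot; rewrite ler_norml => /andP[d1 d2].
apply/andP; split.
  rewrite -[leLHS]ger0_norm ?mulr_ge0//; last by lra.
  rewrite -sqrtr_sqr ler_wsqrtr//.
  rewrite (@le_trans _ _ ((1 - e) * norm2 z ^+ 2))//; last by lra.
  rewrite (@le_trans _ _ (((1 - 4 * e) * ((1 + e) * norm2 z)) ^+ 2))//.
    rewrite lerXn2r ?nnegrE ?mulr_ge0//; first [lra | by rewrite ler_wpM2l//; lra].
  rewrite mulrA exprMn ler_wpM2r ?sqr_ge0//.
  rewrite (@le_trans _ _ ((1 - e) ^+ 2))//; last by nra.
  by rewrite lerXn2r ?nnegrE//; nra.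
rewrite -[leRHS]ger0_norm ?mulr_ge0//; last by lra.
rewrite -sqrtr_sqr ler_wsqrtr//.
rewrite (@le_trans _ _ ((1 + e) * norm2 z ^+ 2))//; first by lra.
rewrite (@le_trans _ _ (((1 + 4 * e) * ((1 - e) * norm2 z)) ^+ 2))//; last first.
  rewrite lerXn2r ?nnegrE ?mulr_ge0//; first [lra | by rewrite ler_wpM2l//; lra].
rewrite (mulrA (1 + 4 * e)) exprMn ler_wpM2r ?sqr_ge0//.
rewrite (@le_trans _ _ ((1 + e) ^+ 2))//; first by nra.
by rewrite lerXn2r ?nnegrE//; nra.
Qed.

(** [A] is invertible but possibly not symmetric, so no square root of [A] is available. With
    [z = (H^-1 A H^-1)^-1 u] the quadratic form of [A^-1] at [H u] is [<u, z>], and [u = z + F z]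
    with [F = H^-1 (A - S) H^-1] small, which is the situation of [perturbed_quadratic]. *)
Lemma normM_inv_near p (S H : 'M[R]_p) (r : R) :
  posdef H -> H *m H = S -> 0 < r < 1 ->
  exists2 d : R, 0 < d & forall A : 'M[R]_p, A \in unitmx ->
    (forall a b, `|A a b - S a b| <= d) ->
    forall u, (1 - r) * normM 1%:M u <= normM (invmx A) (H *m u)
              <= (1 + r) * normM 1%:M u.
Proof.
move=> Hpd HS /andP[r0 r1].
have Hu := posdef_unitmx Hpd; have Hs : H^T = H by case: Hpd.
(* The square accounts for the two factors [H^-1] of [F], the factor in p for [frob_le]; the added
   ones keep [c] positive. *)
pose c := (frob (invmx H) + 1) ^+ 2 * (p%:R + 1).
have H0 := frob_ge0 (invmx H).
have p0 : 0 <= p%:R :> R by [].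
have c0 : 0 < c by rewrite mulr_gt0 ?exprn_gt0//; lra.
exists (r / 4 / c); first by rewrite !divr_gt0.
move=> A Au AS u; set e := r / 4.
have e0 : 0 < e by rewrite divr_gt0.
pose z := invmx (invmx H *m A *m invmx H) *m u.
pose F := invmx H *m (A - S) *m invmx H.
have zE : z = H *m (invmx A *m (H *m u)).
  rewrite /z; apply: (@can_inj _ _ (mulmx (invmx H *m A *m invmx H)) (mulmx (invmx (invmx H *m A *m invmx H)))).
    by apply: mulKmx; rewrite !unitmx_mul !unitmx_inv Hu Au.
  rewrite mulKVmx ?unitmx_mul ?unitmx_inv ?Hu ?Au//.
  by rewrite -!mulmxA (mulKmx Hu) (mulKVmx Au) (mulKmx Hu).
have uE : u = z + F *m z.
  rewrite /F mulmxBr mulmxBl -HS.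
  rewrite (_ : invmx H *m (H *m H) *m invmx H = 1%:M); last first.
    by rewrite mulmxA mulVmx// mul1mx mulmxV.
  rewrite mulmxBl mul1mx addrC subrK /z mulKVmx//.
  by rewrite !unitmx_mul !unitmx_inv Hu Au.
have Fe : frob (A - S) * (frob (invmx H)) ^+ 2 <= e.
  rewrite (@le_trans _ _ ((p%:R * (e / c)) * (frob (invmx H) + 1) ^+ 2))//.
    apply: ler_pM; rewrite ?frob_ge0 ?sqr_ge0//.
      apply: frob_le; first by rewrite divr_ge0 ?ltW.
      by move=> i j; rewrite !mxE; exact: AS.
    by rewrite lerXn2r ?nnegrE//; lra.
  rewrite /c invfM (_ : _ * _ = e * (p%:R / (p%:R + 1))); last first.
    by field; rewrite !gt_eqF//; lra.
  by rewrite ler_piMr ?ltW// ltr_pdivrMr ?mul1r; lra.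
have qE : dotv (H *m u) (invmx A *m (H *m u)) = dotv u z.
  by rewrite zE -!mulmx_dotv trmx_mul Hs -mulmxA.
have Fz : norm2 (F *m z) <= e * norm2 z.
  rewrite (le_trans _ (ler_wpM2r (norm2_ge0 z) Fe))// /F -!mulmxA expr2.
  rewrite (_ : _ * norm2 z = frob (invmx H) * (frob (A - S) * (frob (invmx H) * norm2 z)));
    last by ring.
  rewrite (le_trans (norm2_mulmx _ _))// ler_wpM2l ?frob_ge0//.
  rewrite (le_trans (norm2_mulmx _ _))// ler_wpM2l ?frob_ge0//.
  exact: norm2_mulmx.
have e4 : 0 < e <= 1 / 4 by rewrite e0 /= /e; lra.
have := perturbed_quadratic e4 Fz uE.
rewrite normM1E normME qE (_ : 4 * e = r); last by rewrite /e; lra.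
by move=> /andP[q1 q2]; rewrite !mulrA !ler_wpM2r ?invr_ge0 ?sqrtr_ge0.
Qed.

End EuclideanNorm.

(** * Measurability of events defined by inequalities *)

Section MeasurabilityOfEvents.
Context d (T : measurableType d).

Lemma measurable_forall_nat (A : nat -> set T) :
  (forall n, measurable (A n)) -> measurable [set w | forall n, A n w].
Proof.
move=> mA; rewrite (_ : [set _ | _] = \bigcap_n A n); last first.
  by apply/seteqP; split => w /= H; [move=> n _|move=> n]; exact: H.
exact: bigcapT_measurable.
Qed.

Lemma measurable_forall_fin (I : finType) (A : I -> set T) :
  (forall i, measurable (A i)) -> measurable [set w | forall i, A i w].
Proof.
move=> mA; rewrite (_ : [set _ | _] = \bigcap_(i in [set: I]) A i); last first.
  by apply/seteqP; split => w /= H; [move=> n _|move=> n]; exact: H.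
by apply: fin_bigcap_measurable.
Qed.

Lemma measurable_imply (Q : Prop) (A : set T) :
  (Q -> measurable A) -> measurable [set w | Q -> A w].
Proof.
move=> mA; have [q|nq] := pselect Q.
  rewrite (_ : [set _ | _] = A); first exact: mA.
  by apply/seteqP; split => w //= /(_ q).
rewrite (_ : [set _ | _] = setT)//.
by apply/seteqP; split => // w _ /= q; case: nq.
Qed.

Context {R : realType}.

Lemma measurable_le_cst (f : T -> R) (y : R) :
  measurable_fun setT f -> measurable [set w | f w <= y].
Proof.
move=> mf; rewrite -[X in measurable X]setTI.
exact: (measurable_fun_ler mf (measurable_cst y)).
Qed.

Lemma measurable_lt_cst (f : T -> R) (y : R) :
  measurable_fun setT f -> measurable [set w | y < f w].
Proof.
move=> mf; rewrite -[X in measurable X]setTI.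
exact: (measurable_fun_ltr (measurable_cst y) mf).
Qed.

Lemma measurable_norm2 p (u : T -> 'cV[R]_p) :
  (forall a, measurable_fun setT (fun w => u w a ord0)) ->
  measurable_fun setT (fun w => norm2 (u w)).
Proof.
move=> mu; have ms : measurable_fun setT (@Num.sqrt R).
  by apply: continuous_measurable_fun; exact: sqrt_continuous.
apply: (measurableT_comp ms).
by apply: measurable_sum => a; exact: measurable_funX.
Qed.

Lemma measurable_mulmx m n (M : 'M[R]_(m, n)) (u : T -> 'cV[R]_n) :
  (forall a, measurable_fun setT (fun w => u w a ord0)) ->
  forall a, measurable_fun setT (fun w => (M *m u w) a ord0).
Proof.
move=> mu a; under eq_fun do rewrite mxE.
by apply: measurable_sum => i; apply: measurable_funM.
Qed.

End MeasurabilityOfEvents.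

(** * The Gaussian supremum on a grid and its law *)

(** Gaussian counterpart of [stat_term] as rewritten in [stat_termE]: same weight, with [u] and [v]
    in place of the centred partial sums at j and k. *)
Definition grid_term {R : realType} {p : nat} (eta : R) (m j k : nat)
    (u v : 'cV[R]_p) : R :=
  powR (m%:R / k%:R) (3 / 2 + eta) / powR m%:R (3 / 2) *
    normM 1%:M (k%:R *: u - j%:R *: v).

(* [b j] is the value of a path at the grid point [m + j]. *)
Definition grid_event {R : realType} {p : nat} (eta : R) (m : nat) (y : R)
    (T : Type) (b : nat -> T -> 'cV[R]_p) : set T :=
  [set w | forall j k, (j < k)%N ->
     grid_term eta m (m + j) (m + k) (b j w) (b k w) <= y].

(** The initial value counts as increment 0, so the increments determine the path; [sum_path] is the
    inverse operation. *)
Definition incr {R : realType} {p : nat} (T : Type) (b : nat -> T -> 'cV[R]_p)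
    (i : nat) (w : T) : 'cV[R]_p :=
  if i is i'.+1 then b i w - b i' w else b 0 w.

Section GridLaw.
Context {R : realType} {p : nat} (eta : R) (m : nat) (y : R).

Lemma measurable_grid_term d (T : measurableType d) (j k : nat)
    (u v : T -> 'cV[R]_p) :
  (forall a, measurable_fun setT (fun w => u w a ord0)) ->
  (forall a, measurable_fun setT (fun w => v w a ord0)) ->
  measurable_fun setT (fun w => grid_term eta m j k (u w) (v w)).
Proof.
move=> mu mv; apply: measurable_funM => //.
under eq_fun do rewrite normM1E.
apply: measurable_funM => //; apply: measurable_norm2 => a.
under eq_fun do rewrite !mxE.
by apply: measurable_funB; apply: measurable_funM.
Qed.

Lemma measurable_grid_event d (T : measurableType d) (b : nat -> T -> 'cV[R]_p) :
  (forall j a, measurable_fun setT (fun w => b j w a ord0)) ->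
  measurable (grid_event eta m y b).
Proof.
move=> mb; apply: measurable_forall_nat => j; apply: measurable_forall_nat => k.
apply: measurable_imply => _; apply: measurable_le_cst.
exact: measurable_grid_term.
Qed.

Definition sum_path n (z : 'I_n * 'I_p -> R) (j : nat) : 'cV[R]_p :=
  \col_a \sum_(i < n | (i <= j)%N) z (i, a).

Lemma measurable_sum_path d (T : measurableType d) n (Z : 'I_n * 'I_p -> T -> R) j a :
  (forall i, measurable_fun setT (Z i)) ->
  measurable_fun setT (fun w => sum_path (fun i => Z i w) j a ord0).
Proof.
move=> mZ; under eq_fun do rewrite mxE big_mkcond.
have H (i : 'I_n) : measurable_fun setT (fun w => if (i <= j)%N then Z (i, a) w else 0).
  by case: (i <= j)%N.
exact: (measurable_sum _ H).
Qed.

Lemma sum_path_incr (T : Type) (b : nat -> T -> 'cV[R]_p) n j w : (j < n)%N ->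
  sum_path (fun i : 'I_n * 'I_p => incr b i.1 w i.2 ord0) j = b j w.
Proof.
move=> jn; apply/colP => a; rewrite mxE /=.
rewrite -(big_ord_widen n (fun i => incr b i w a ord0) jn).
elim: j {jn} => [|j IH]; first by rewrite big_ord1.
by rewrite big_ord_recr IH /= !mxE addrC subrK.
Qed.

(** The inequalities with indices up to n form a measurable condition on the first n + 1 increments,
    so rectangles decide their probability. The full event is the decreasing intersection of these
    conditions. *)
Lemma grid_event_law d (T : measurableType d) d' (T' : measurableType d')
    (P : probability T R) (P' : probability T' R)
    (b : nat -> T -> 'cV[R]_p) (b' : nat -> T' -> 'cV[R]_p) :
  (forall j a, measurable_fun setT (fun w => b j w a ord0)) ->
  (forall j a, measurable_fun setT (fun w => b' j w a ord0)) ->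
  (forall n (B : 'I_n.+1 * 'I_p -> set R), (forall i, measurable (B i)) ->
    P [set w | forall i, B i (incr b i.1 w i.2 ord0)] =
    P' [set w | forall i, B i (incr b' i.1 w i.2 ord0)]) ->
  P (grid_event eta m y b) = P' (grid_event eta m y b').
Proof.
move=> mb mb' H.
have mi d0 (T0 : measurableType d0) (c : nat -> T0 -> 'cV[R]_p) :
    (forall j a, measurable_fun setT (fun w => c j w a ord0)) ->
    forall i a, measurable_fun setT (fun w => incr c i w a ord0).
  move=> mc [|i] a //=; under eq_fun do rewrite !mxE.
  exact: measurable_funB.
pose A n : set ('I_n.+1 * 'I_p -> R) := [set z | forall j k, (j < k)%N ->
  (k < n.+1)%N -> grid_term eta m (m + j) (m + k) (sum_path z j) (sum_path z k) <= y].
have mA n : measurable (A n : set (g_sigma_algebraType (@rectangles R ('I_n.+1 * 'I_p)%type))).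
  apply: measurable_forall_nat => j; apply: measurable_forall_nat => k.
  apply: measurable_imply => _; apply: measurable_imply => _.
  apply: measurable_le_cst.
  by apply: measurable_grid_term => a;
    apply: (@measurable_sum_path _ (g_sigma_algebraType (@rectangles R ('I_n.+1 * 'I_p)%type))
      n.+1 (fun i x => x i)); exact: measurable_coord.
pose A0 (T0 : Type) (c : nat -> T0 -> 'cV[R]_p) n : set T0 :=
  (fun w (i : 'I_n.+1 * 'I_p) => incr c i.1 w i.2 ord0) @^-1` A n.
have A0E (T0 : Type) (c : nat -> T0 -> 'cV[R]_p) n w : A0 T0 c n w <->
    forall j k, (j < k)%N -> (k < n.+1)%N ->
      grid_term eta m (m + j) (m + k) (c j w) (c k w) <= y.
  by split=> /= + j k jk kn => /(_ j k jk kn); rewrite !sum_path_incr// (ltn_trans jk).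
have geE (T0 : Type) (c : nat -> T0 -> 'cV[R]_p) :
    grid_event eta m y c = \bigcap_n A0 T0 c n.
  apply/seteqP; split => w /=.
    by move=> G n _; apply/A0E => j k jk _; exact: G.
  by move=> G j k jk; have /A0E := G k I; apply.
have cvgA d0 (T0 : measurableType d0) (Q : probability T0 R) (c : nat -> T0 -> 'cV[R]_p) :
    (forall j a, measurable_fun setT (fun w => c j w a ord0)) ->
    (Q \o A0 T0 c) n @[n --> \oo] --> Q (grid_event eta m y c).
  move=> mc; have mA0 n : measurable (A0 T0 c n).
    rewrite -[X in measurable X]setTI.
    exact: (measurable_family (Z := fun (i : 'I_n.+1 * 'I_p) w => incr c i.1 w i.2 ord0)
      (fun i => mi _ _ _ mc i.1 i.2) measurableT (mA n)).
  rewrite geE; apply: nonincreasing_cvg_mu => //.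
  - by rewrite (le_lt_trans (probability_le1 _ (mA0 0%N)))// ltry.
  - exact: bigcapT_measurable.
  move=> n1 n2 n12; apply/subsetPset => w /A0E G; apply/A0E => j k jk kn.
  by apply: G => //; exact: leq_trans kn _.
apply: (@cvg_unique _ (@ereal_hausdorff R) ((P \o A0 _ b) n @[n --> \oo])).
  exact: cvgA.
rewrite (_ : P \o A0 _ b = P' \o A0 _ b'); first exact: cvgA.
apply/funext => n /=.
apply: (rectangles_law_unique (Z := fun i : 'I_n.+1 * 'I_p => fun w => incr b i.1 w i.2 ord0)
  (Z' := fun i : 'I_n.+1 * 'I_p => fun w => incr b' i.1 w i.2 ord0)) => //.
- by move=> i; exact: mi.
- by move=> i; exact: mi.
- by rewrite (le_lt_trans (probability_le1 P measurableT))// ltry.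
- exact: H.
- exact: mA.
Qed.

End GridLaw.

(** * Independence of two processes beyond rectangles *)

Section IndependentProcesses.
Context {R : realType} d (T : measurableType d) (P : probability T R) (p : nat).
Variables (W1 W2 : R -> T -> 'cV[R]_p).
Hypothesis mW1 : forall t a, measurable_fun setT (fun w => W1 t w a ord0).
Hypothesis mW2 : forall t a, measurable_fun setT (fun w => W2 t w a ord0).
Hypothesis W12 : indep_processes P W1 W2.

Lemma indep_processes_rect (I1 I2 : finType) (t1 : I1 -> R) (j1 : I1 -> 'I_p)
    (t2 : I2 -> R) (j2 : I2 -> 'I_p) (B1 : I1 -> set R) (B2 : I2 -> set R) :
  (forall i, measurable (B1 i)) -> (forall i, measurable (B2 i)) ->
  P ([set w | forall i, B1 i (W1 (t1 i) w (j1 i) ord0)] `&`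
     [set w | forall i, B2 i (W2 (t2 i) w (j2 i) ord0)]) =
  (P [set w | forall i, B1 i (W1 (t1 i) w (j1 i) ord0)] *
   P [set w | forall i, B2 i (W2 (t2 i) w (j2 i) ord0)])%E.
Proof.
move=> mB1 mB2.
have cylE (I : finType) (W : R -> T -> 'cV[R]_p) (t : I -> R) (j : I -> 'I_p) (B : I -> set R) :
    [set w | forall i, B i (W (t i) w (j i) ord0)] =
    cyl_event W (fun k : 'I_#|I| => t (enum_val k)) (fun k => j (enum_val k))
      (fun k => B (enum_val k)).
  apply/seteqP; split => w /= H; first by move=> k _; exact: H.
  by move=> i; have := H (enum_rank i) Logic.I; rewrite /= !enum_rankK.
by rewrite (cylE I1 W1 t1 j1 B1) (cylE I2 W2 t2 j2 B2); exact: W12.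
Qed.

(** Events about increments of [W1] are not rectangles in its values, so the [W1] side has to be a
    general measurable set. For fixed [E] on the [W2] side, [P] restricted to [E] and [P E] times
    [P] are finite measures agreeing on rectangles. *)
Lemma indep_processes_family (I1 I2 : finType) (t1 : I1 -> R) (j1 : I1 -> 'I_p)
    (t2 : I2 -> R) (j2 : I2 -> 'I_p) (B2 : I2 -> set R)
    (A : set (g_sigma_algebraType (@rectangles R I1))) :
  (forall i, measurable (B2 i)) -> measurable A ->
  P (((fun w i => W1 (t1 i) w (j1 i) ord0) @^-1` A) `&`
     [set w | forall i, B2 i (W2 (t2 i) w (j2 i) ord0)]) =
  (P ((fun w i => W1 (t1 i) w (j1 i) ord0) @^-1` A) *
   P [set w | forall i, B2 i (W2 (t2 i) w (j2 i) ord0)])%E.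
Proof.
move=> mB2 mA; set E := [set w | forall i, B2 i _].
have mE : measurable E.
  apply: measurable_forall_fin => i; rewrite -[X in measurable X]setTI.
  exact: mW2.
have PE0 : 0 <= fine (P E) by exact: fine_ge0.
have PEE : (fine (P E))%:E = P E by rewrite fineK// fin_num_measure.
pose mu := mrestr P mE; pose mu' := mscale (NngNum PE0) P.
have mu'E B : mu' B = (P B * P E)%E by rewrite /mu' /mscale /= PEE muleC.
rewrite -mu'E -[LHS]/(mu _).
apply: (rectangles_law_unique (Z := fun i w => W1 (t1 i) w (j1 i) ord0)
  (Z' := fun i w => W1 (t1 i) w (j1 i) ord0)) => //.
  have muT : mu setT = P E by rewrite /mu /mrestr setTI.
  by rewrite -[X in (X < _)%E]/(mu setT) muT (le_lt_trans (probability_le1 P mE))// ltry.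
by move=> B mB; rewrite -[RHS]/(mu' _) mu'E; exact: indep_processes_rect.
Qed.

End IndependentProcesses.

(** * Increments of the rescaled path and of the glued path *)

Section BrownianGrid.
Context {R : realType} d (T : measurableType d) (P : probability T R) (p : nat).

(* Standard deviation of the i-th increment of a Brownian path started at time 0
   and then observed at the times m, m + 1, m + 2, ... *)
Definition grid_sd (m i : nat) : R := if i is _.+1 then 1 else Num.sqrt m%:R.

(** The factor [c] is [sqrt m] for the rescaled path and 1 for the glued one. *)
Lemma BM_increments (W : R -> T -> 'cV[R]_p) n (ts : nat -> R) (c : R)
    (B : 'I_n * 'I_p -> set R) :
  std_BM P W -> 0 <= ts 0 -> (forall k, ts k < ts k.+1) -> 0 < c ->
  (forall i, measurable (B i)) ->
  P [set w | forall i : 'I_n * 'I_p,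
       B i (c * (W (ts i.1.+1) w i.2 ord0 - W (ts i.1) w i.2 ord0))] =
  (\prod_(i : 'I_n * 'I_p) normal_prob 0 (c * Num.sqrt (ts i.1.+1 - ts i.1)%R) (B i))%E.
Proof.
move=> [_ _ _ H] ts0 tsS c0 mB.
pose t (k : 'I_n.+1) := ts k.
have tlift (k : 'I_n) : t (lift ord0 k) = ts k.+1 by rewrite /t lift0.
have [|indep law] := H n t ts0; first by move=> k; rewrite tlift; exact: tsS.
pose B' i := *%R c @^-1` B i.
have mB' i : measurable (B' i).
  rewrite -[X in measurable X]setTI.
  by apply: (@measurable_funM _ _ R setT (cst c) id) => //; exact: mB.
rewrite (_ : [set w | _] = \bigcap_(i in [set: 'I_n * 'I_p]) ((fun w =>
    W (t (lift ord0 i.1)) w i.2 ord0 -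
    W (t (widen_ord (leqnSn n) i.1)) w i.2 ord0) @^-1` B' i)); last first.
  by apply/seteqP; split => w G; [move=> i _; move: (G i)|move=> i; move: (G i I)];
    rewrite /B' /preimage /mkset tlift.
rewrite indep//; apply: eq_bigr => i _.
rewrite law; last exact: mB'.
rewrite normal_prob_scale; [by rewrite tlift|exact: c0| |exact: mB].
by rewrite gt_eqF// sqrtr_gt0 subr_gt0 tlift; exact: tsS.
Qed.

Lemma scaled_BM_increments (W : R -> T -> 'cV[R]_p) m n
    (B : 'I_n.+1 * 'I_p -> set R) :
  std_BM P W -> (0 < m)%N -> (forall i, measurable (B i)) ->
  P [set w | forall i, B i (incr (fun j w => Num.sqrt m%:R *:
                              W ((m + j)%:R / m%:R) w) i.1 w i.2 ord0)] =
  (\prod_(i : 'I_n.+1 * 'I_p) normal_prob 0 (grid_sd m i.1) (B i))%E.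
Proof.
move=> BM m0 mB; have m0' : 0 < m%:R :> R by rewrite ltr0n.
(* Time 0 is put in front of the grid: since [W 0 = 0], the increment over [0, 1] is the initial
   value of the grid path. *)
pose ts k : R := if k is k'.+1 then (m + k')%:R / m%:R else 0.
have tsS k : ts k < ts k.+1.
  case: k => [|k] /=; first by rewrite divr_gt0// ltr0n addn_gt0 m0.
  by rewrite ltr_pM2r ?invr_gt0// ltr_nat addnS.
have c0 : 0 < Num.sqrt (m%:R : R) by rewrite sqrtr_gt0.
have := @BM_increments W n.+1 ts (Num.sqrt m%:R) B BM (lexx _) tsS c0 mB.
have sdE i : Num.sqrt m%:R * Num.sqrt (ts i.+1 - ts i) = grid_sd m i.
  case: i => [|i] /=; first by rewrite addn0 divff ?gt_eqF// subr0 sqrtr1 mulr1.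
  rewrite -mulrBl -natrB; last by rewrite leq_add2l.
  rewrite (_ : (m + i.+1 - (m + i))%N = 1%N); last by rewrite subnDl subSnn.
  by rewrite mul1r -sqrtrM ?ltW// divff ?gt_eqF// sqrtr1.
rewrite (eq_bigr (fun i : 'I_n.+1 * 'I_p =>
  normal_prob 0 (grid_sd m i.1) (B i))); last first.
  by move=> i _; rewrite sdE.
move=> <-.
have W0 w : W 0 w = 0 by case: BM.
congr (P _); apply/seteqP; split => w /= H [[[|i] ii] a]; have := H (Ordinal ii, a);
  by rewrite /= ?W0 ?mxE /= ?mulrBr ?mulr0 ?subr0.
Qed.

(** Increment 0 is [W2 m] because [W1 0 = 0], and the later ones are increments of [W1] alone;
    independence joins the two products. *)
Lemma glued_BM_increments (W1 W2 : R -> T -> 'cV[R]_p) m n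
    (B : 'I_n.+1 * 'I_p -> set R) :
  std_BM P W1 -> std_BM P W2 -> indep_processes P W1 W2 -> (0 < m)%N ->
  (forall i, measurable (B i)) ->
  P [set w | forall i, B i (incr (fun j w => W2 m%:R w + W1 j%:R w)
                              i.1 w i.2 ord0)] =
  (\prod_(i : 'I_n.+1 * 'I_p) normal_prob 0 (grid_sd m i.1) (B i))%E.
Proof.
move=> BM1 BM2 W12 m0 mB; have m0' : 0 < m%:R :> R by rewrite ltr0n.
have [mW1 W10 _ _] := BM1; have [mW2 W20 _ _] := BM2.
pose B2 (i : 'I_1 * 'I_p) := B (ord0, i.2).
pose B1 (i : 'I_n * 'I_p) := B (lift ord0 i.1, i.2).
(* Only the times 0 and m matter; [k * m] extends them to a strictly increasing sequence. *)
have := @BM_increments W2 1 (fun k => (k * m)%:R) 1 B2 BM2 (lexx _) _ ltr01 (fun i => mB _).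
have := @BM_increments W1 n (fun k => k%:R) 1 B1 BM1 (lexx _) _ ltr01 (fun i => mB _).
move=> H1 H2.
pose A : set (g_sigma_algebraType (@rectangles R ('I_n.+1 * 'I_p)%type)) :=
  [set x | forall i : 'I_n * 'I_p, B1 i (1 * (x (lift ord0 i.1, i.2) -
     x (widen_ord (leqnSn n) i.1, i.2)))].
have mA : measurable A.
  apply: measurable_forall_fin => i; rewrite -[X in measurable X]setTI.
  apply: measurable_funM => //; last exact: mB.
  by apply: measurable_funB; exact: measurable_coord.
have := @indep_processes_family _ _ _ _ _ _ _ mW1 mW2 W12 _ _
  (fun i : 'I_n.+1 * 'I_p => (i.1 : nat)%:R) snd (fun i : 'I_1 * 'I_p => m%:R) snd B2 A (fun i => mB _) mA.
rewrite (_ : _ @^-1` A = [set w | forall i : 'I_n * 'I_p, B1 i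
    (1 * (W1 i.1.+1%:R w i.2 ord0 - W1 (i.1 : nat)%:R w i.2 ord0))]); last first.
  by apply/seteqP; split => w G i; move: (G i); rewrite /preimage /mkset lift0.
rewrite H1; last by move=> k; rewrite ltr_nat.
rewrite (_ : [set w | forall i, B2 i _] = [set w | forall i : 'I_1 * 'I_p, B2 i
    (1 * (W2 (i.1.+1 * m)%:R w i.2 ord0 - W2 (i.1 * m)%:R w i.2 ord0))]); last first.
  by apply/seteqP; split => w /= G i; have := G i; rewrite /= !ord1/= mul1n mul0n W20 mxE subr0 mul1r.
rewrite H2; last by move=> k; rewrite ltr_nat mulSn -{1}(add0n (k * m)%N) ltn_add2r.
rewrite [X in (_ * X)%E](eq_bigr (fun i : 'I_1 * 'I_p =>
  normal_prob 0 (grid_sd m 0) (B (ord0, i.2)))); last first.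
  move=> [i a] _; by rewrite /B2 /= ord1 /= mul1n mul0n subr0 mul1r.
rewrite [X in (X * _)%E](eq_bigr (fun i : 'I_n * 'I_p =>
  normal_prob 0 (grid_sd m (lift ord0 i.1)) (B (lift ord0 i.1, i.2)))); last first.
  move=> [i a] _; rewrite /B1 lift0 /grid_sd -natrB; last exact: leqnSn.
  by rewrite subSnn sqrtr1 mul1r.
rewrite -(pair_bigA _ (fun (i : 'I_1) a => normal_prob 0 (grid_sd m 0) (B (ord0, a)))).
rewrite big_ord1 -(pair_bigA _ (fun (i : 'I_n) a =>
  normal_prob 0 (grid_sd m (lift ord0 i)) (B (lift ord0 i, a)))).
have prodE : (\prod_(i : 'I_n.+1 * 'I_p) normal_prob 0 (grid_sd m i.1) (B i))%E =
    (\prod_(i < n.+1) \prod_(a < p) normal_prob 0 (grid_sd m i) (B (i, a)))%E.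
  by rewrite pair_bigA; apply: eq_bigr => -[i a] _.
rewrite prodE big_ord_recl => H; rewrite muleC -H; congr (P _).
apply/seteqP; split => w; rewrite /setI /mkset.
  move=> G; split.
    move=> [i a]; move: (G (lift ord0 i, a)); rewrite /B1 lift0 /incr !mxE mul1r.
    by rewrite opprD addrACA subrr add0r.
  move=> [i a]; move: (G (ord0, a)).
  by rewrite (ord1 i) /B2 /incr /= W10 mul1n mul0n W20 !mxE addr0 subr0 mul1r.
move=> [G1 G2] [i a]; have [->|[k ->]] : i = ord0 \/ exists k, i = lift ord0 k.
    by case: (unliftP ord0 i) => [k ->|->]; [right; exists k|left].
  move: (G2 (ord0, a)).
  by rewrite /B2 /incr /= W10 mul1n mul0n W20 !mxE addr0 subr0 mul1r.
move: (G1 (k, a)); rewrite /B1 lift0 /incr !mxE mul1r.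
by rewrite opprD addrACA subrr add0r.
Qed.

End BrownianGrid.

(** * Approximation of the limiting functional by grids *)

Section GridApproximation.
Context {R : realType}.

Lemma cvg_sum_seq (I : Type) (r : seq I) (f : I -> nat -> R) (l : I -> R) :
  (forall i, f i @ \oo --> l i) ->
  (fun m => \sum_(i <- r) f i m) @ \oo --> \sum_(i <- r) l i.
Proof.
move=> H; elim: r => [|i r IH].
  by under eq_fun do rewrite big_nil; rewrite big_nil; exact: cvg_cst.
by under eq_fun do rewrite big_cons; rewrite big_cons; exact: cvgD.
Qed.

Lemma cvg_norm2 p (u : nat -> 'cV[R]_p) (l : 'cV[R]_p) :
  (forall a, (fun m => u m a ord0) @ \oo --> l a ord0) ->
  (fun m => norm2 (u m)) @ \oo --> norm2 l.
Proof.
move=> H; apply: (cvg_comp _ (@Num.sqrt R)); last exact: sqrt_continuous.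
apply: (cvg_sum_seq (f := fun a m => u m a ord0 ^+ 2) (l := fun a => l a ord0 ^+ 2)).
by move=> a; under eq_fun do rewrite expr2; rewrite expr2; exact: cvgM.
Qed.

Lemma cvg_dist_invS (u : nat -> R) (l : R) :
  (forall m, `|u m - l| <= m.+1%:R^-1) -> u @ \oo --> l.
Proof.
move=> H; apply/cvgrPdist_le => e e0.
have /cvgrPdist_le /(_ e e0) := @cvg_harmonic R.
apply: filterS => m; rewrite sub0r normrN ger0_norm ?invr_ge0// => me.
by rewrite distrC (le_trans (H m)).
Qed.

(** Index j of the last grid point [(m + j) / m] not exceeding [s]. *)
Definition grid_floor (m : nat) (s : R) : nat := Num.truncn (m%:R * (s - 1)).

Lemma grid_floorP m s : (0 < m)%N -> 1 <= s ->
  (m + grid_floor m s)%:R / m%:R <= s < (m + (grid_floor m s).+1)%:R / m%:R.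
Proof.
move=> m0 s1; have m0' : 0 < m%:R :> R by rewrite ltr0n.
have H : 0 <= m%:R * (s - 1) by rewrite mulr_ge0// subr_ge0.
have /andP[t1 t2] := truncn_itv H.
by rewrite ler_pdivrMr// ltr_pdivlMr// !natrD /grid_floor; apply/andP; split; lra.
Qed.

Lemma grid_pointS m j : (m + j.+1)%:R / m%:R = (m + j)%:R / m%:R + m%:R^-1 :> R.
Proof. by rewrite addnS -natr1 mulrDl mul1r. Qed.

Lemma cvg_grid_floor (s : R) : 1 <= s ->
  (fun m => (m.+1 + grid_floor m.+1 s)%:R / m.+1%:R : R) @ \oo --> s.
Proof.
move=> s1; apply: cvg_dist_invS => m.
have /andP[] := @grid_floorP m.+1 s isT s1.
have : 0 <= m.+1%:R^-1 :> R by [].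
rewrite grid_pointS; move: (m.+1%:R^-1) ((m.+1 + grid_floor m.+1 s)%:R / m.+1%:R).
move=> i x i0 h1 h2.
by rewrite ler_norml; apply/andP; split; lra.
Qed.

Lemma cvg_grid_ceil (s : R) : 1 <= s ->
  (fun m => (m.+1 + (grid_floor m.+1 s).+1)%:R / m.+1%:R : R) @ \oo --> s.
Proof.
move=> s1; apply: cvg_dist_invS => m.
have /andP[] := @grid_floorP m.+1 s isT s1.
have : 0 <= m.+1%:R^-1 :> R by [].
rewrite grid_pointS; move: (m.+1%:R^-1) ((m.+1 + grid_floor m.+1 s)%:R / m.+1%:R).
move=> i x i0 h1 h2.
by rewrite ler_norml; apply/andP; split; lra.
Qed.

Definition contrast p (eta : R) (T : Type) (W : R -> T -> 'cV[R]_p) (s t : R) (w : T) : R :=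
  powR t (- (3 / 2) - eta) * normM 1%:M (t *: W s w - s *: W t w).

Lemma contrast_ge0 p eta (T : Type) (W : R -> T -> 'cV[R]_p) s t w :
  0 <= contrast eta W s t w.
Proof. by rewrite mulr_ge0 ?powR_ge0 ?normM_ge0. Qed.

Lemma Lpeta_leP p eta (T : Type) (W : R -> T -> 'cV[R]_p) (y : R) w :
  (Lpeta W eta w <= y%:E)%E <->
  forall s t, 1 <= s <= t -> contrast eta W s t w <= y.
Proof.
split=> [H s t st|H].
  rewrite -lee_fin (le_trans _ H)//; apply: ereal_sup_ubound.
  by exists s, t.
by apply: ge_ereal_sup => _ [s [t [st ->]]]; rewrite lee_fin; exact: H.
Qed.

(** A point [s > 0] is interior to the half-line, where continuity within it is ordinary
    continuity. *)
Lemma cvg_path (V : R -> R) (s : R) (u : nat -> R) :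
  {within [set t : R | 0 <= t], continuous V} -> 0 < s -> u @ \oo --> s ->
  (V \o u) @ \oo --> V s.
Proof.
move=> cV s0 us; apply: (cvg_comp _ V us).
have : {within `]0, +oo[%classic, continuous V}.
  apply: continuous_subspaceW cV => x /=; rewrite in_itv /= andbT; exact: ltW.
rewrite continuous_open_subspace; last exact: interval_open.
by apply; rewrite inE /= in_itv /= s0.
Qed.

Lemma cvg_contrast p eta (T : Type) (W : R -> T -> 'cV[R]_p) (s t : R) w
    (u v : nat -> R) :
  (forall a, {within [set t : R | 0 <= t], continuous (fun t => W t w a ord0)}) ->
  1 <= s -> 1 <= t -> u @ \oo --> s -> v @ \oo --> t -> (forall m, 0 < v m) ->
  (fun m => contrast eta W (u m) (v m) w) @ \oo --> contrast eta W s t w.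
Proof.
move=> cW s1 t1 us vt v0; have t0 : 0 < t by rewrite (lt_le_trans ltr01).
have s0 : 0 < s by rewrite (lt_le_trans ltr01).
apply: cvgM.
  have powE x : 0 < x -> powR x (- (3 / 2) - eta) = expR ((- (3 / 2) - eta) * ln x).
    by move=> x0; rewrite /powR gt_eqF.
  rewrite powE//; under eq_fun do rewrite powE//.
  apply: (cvg_comp _ expR); last exact: continuous_expR.
  apply: cvgMr; apply: (cvg_comp _ (@ln R) vt).
  exact: continuous_ln.
under eq_fun do rewrite normM1E; rewrite normM1E.
apply: cvgM; last exact: cvg_cst.
apply: cvg_norm2 => a; under eq_fun do rewrite !mxE; rewrite !mxE.
apply: cvgB; apply: cvgM => //.
  exact: (cvg_path (V := fun t => W t w a ord0)).
exact: (cvg_path (V := fun t => W t w a ord0)).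
Qed.

(** Brownian scaling: at times [m s] and [m t] the vector carries the factor [m * sqrt m], which
    cancels the [m^(3/2)] of the weight. *)
Lemma scaled_grid_term p eta (T : Type) (W : R -> T -> 'cV[R]_p) m j k w :
  (0 < m)%N ->
  grid_term eta m (m + j) (m + k) (Num.sqrt m%:R *: W ((m + j)%:R / m%:R) w)
    (Num.sqrt m%:R *: W ((m + k)%:R / m%:R) w) =
  contrast eta W ((m + j)%:R / m%:R) ((m + k)%:R / m%:R) w.
Proof.
move=> m0; have m0' : 0 < m%:R :> R by rewrite ltr0n.
rewrite /grid_term /contrast; set s := _%:R / m%:R; set t := _%:R / m%:R.
have t0 : 0 < t by rewrite divr_gt0// ltr0n addn_gt0 m0.
have sE : (m + j)%:R = m%:R * s by rewrite mulrC divfK// gt_eqF.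
have tE : (m + k)%:R = m%:R * t by rewrite mulrC divfK// gt_eqF.
move: s t t0 sE tE => s t t0 -> ->.
rewrite (_ : _ *: _ - _ = (m%:R * Num.sqrt m%:R) *: (t *: W s w - s *: W t w)).
  rewrite normMZ invfM (mulrA m%:R m%:R^-1) divff ?gt_eqF// mul1r.
  rewrite -(powR_inv1 (ltW t0)) -powRrM mulN1r opprD.
  rewrite ger0_norm ?mulr_ge0 ?sqrtr_ge0 ?ltW//.
  rewrite mulrA; congr (_ * _).
  rewrite -mulrA [X in _ * X](_ : _ = 1) ?mulr1//.
  rewrite -powR12_sqrt ?ltW// -{2}(powRr1 (ltW m0')) -powRD; last by rewrite gt_eqF.
  rewrite (_ : 3 / 2 = 1 + 2^-1); last by lra.
  by rewrite mulVf// gt_eqF// powR_gt0.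
by rewrite scalerBr !scalerA; congr (_ *: _ - _ *: _); ring.
Qed.

Definition scaled_grid p (T : Type) (W : R -> T -> 'cV[R]_p) (m j : nat) (w : T) :=
  Num.sqrt m%:R *: W ((m + j)%:R / m%:R) w.

Lemma Lpeta_le_grid_event p eta (T : Type) (W : R -> T -> 'cV[R]_p) y m : (0 < m)%N ->
  [set w | (Lpeta W eta w <= y%:E)%E] `<=` grid_event eta m y (scaled_grid W m).
Proof.
move=> m0 w /Lpeta_leP H j k jk; rewrite scaled_grid_term//; apply: H.
have m0' : 0 < m%:R :> R by rewrite ltr0n.
rewrite ler_pdivlMr// mul1r ler_nat leq_addr ler_pM2r ?invr_gt0//.
by rewrite ler_nat leq_add2l ltnW.
Qed.

(** A contrast above [y] at some [(s, t)] stays above [y] at nearby grid points for all large m, so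
    [w] then lies in only finitely many grid events. *)
Lemma lim_sup_grid_event p eta (T : Type) (W : R -> T -> 'cV[R]_p) y :
  (forall w a, {within [set t : R | 0 <= t], continuous (fun t => W t w a ord0)}) ->
  lim_sup_set (fun m => grid_event eta m.+1 y (scaled_grid W m.+1)) =
  [set w | (Lpeta W eta w <= y%:E)%E].
Proof.
move=> cW; apply/seteqP; split => w; last first.
  by move=> H n _; exists n => //=; exact: Lpeta_le_grid_event.
move=> H; apply/Lpeta_leP => s t /andP[s1 st].
have t1 : 1 <= t := le_trans s1 st.
rewrite leNgt; apply/negP => yst.
(* Approaching [s] from below and [t] from above keeps the grid indices strictly ordered even when
   [s = t]. *)
have := cvg_contrast (eta := eta) (cW w) s1 t1 (cvg_grid_floor s1) (cvg_grid_ceil t1).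
have v0 m : 0 < (m.+1 + (grid_floor m.+1 t).+1)%:R / m.+1%:R :> R by rewrite divr_gt0.
move=> /(_ v0) /cvgr_gt /(_ _ yst) [N _ HN].
have [m /= Nm] := H N I; move=> /(_ (grid_floor m.+1 s) (grid_floor m.+1 t).+1).
rewrite scaled_grid_term// leNgt (HN m Nm) => /(_ _)/negP; apply => //.
rewrite ltnS; apply: le_truncn; rewrite ler_wpM2l//; lra.
Qed.

End GridApproximation.

(** * Finite and geometric union bounds *)

Section UnionBounds.
Context {R : realType} d (T : measurableType d) (P : probability T R).

Lemma measurable_exists_fin (I : finType) (A : I -> set T) :
  (forall i, measurable (A i)) -> measurable [set w | exists i, A i w].
Proof.
move=> mA; rewrite (_ : [set _ | _] = \bigcup_(i in [set: I]) A i).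
  by apply: fin_bigcup_measurable.
by apply/seteqP; split => w /= => [[i]|[i _]]; exists i.
Qed.

Lemma finite_union_bound (I : finType) (A : I -> set T) (c : R) :
  (forall i, measurable (A i)) -> (forall i, (P (A i) <= c%:E)%E) ->
  (P [set w | exists i, A i w] <= (#|I|%:R * c)%:E)%E.
Proof.
move=> mA PA.
have mB (s : seq I) : measurable [set w | exists2 i, i \in s & A i w].
  elim: s => [|i s IH].
    by rewrite (_ : [set _ | _] = set0)//; apply/seteqP; split => w //= [].
  rewrite (_ : [set _ | _] = A i `|` [set w | exists2 i, i \in s & A i w]).
    exact: measurableU.
  apply/seteqP; split => w /=.
    by move=> [j]; rewrite inE => /orP[/eqP ->|js Aj]; [left|right; exists j].
  by move=> [Ai|[j js Aj]]; [exists i; rewrite ?mem_head|exists j; rewrite // inE js orbT].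
rewrite (_ : [set _ | _] = [set w | exists2 i, i \in enum I & A i w]); last first.
  apply/seteqP; split => w /=; first by move=> [i Ai]; exists i; rewrite ?mem_enum.
  by move=> [i _ Ai]; exists i.
rewrite cardE; elim: (enum I) => [|i s IH].
  rewrite (_ : [set _ | _] = set0) ?measure0 ?mul0r//.
  by apply/seteqP; split => w //= [].
rewrite (@le_trans _ _ (P (A i `|` [set w | exists2 i, i \in s & A i w])))//.
  apply: le_measure; rewrite ?inE//; first exact: measurableU.
  by move=> w /= [j]; rewrite inE => /orP[/eqP ->|js Aj]; [left|right; exists j].
have /le_trans := measureU2 P (mA i) (mB s); apply.
rewrite /= -natr1 mulrDl mul1r addrC EFinD.
exact: leeD.
Qed.

Lemma geometric_union_bound (A : nat -> set T) (c r : R) :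
  0 <= c -> 0 < r < 1 -> (forall n, measurable (A n)) ->
  (forall n, (P (A n) <= (c * r ^+ n)%:E)%E) ->
  (P (\bigcup_n A n) <= (c / (1 - r))%:E)%E.
Proof.
move=> c0 /andP[r0 r1] mA PA.
have := @measure_sigma_subadditive _ _ _ P (\bigcup_n A n) A mA
  (bigcupT_measurable _ mA).
move=> /(_ (fun w Aw => Aw))/le_trans; apply.
apply: lime_le; first exact: is_cvg_nneseries.
apply: nearW => n.
rewrite (@le_trans _ _ (\sum_(0 <= i < n) (c * r ^+ i)%:E)%E)//.
  by apply: lee_sum => i _; exact: PA.
rewrite sumEFin lee_fin; have := @geometric_le_lim R n c r c0 r0.
by rewrite (ger0_norm (ltW r0)) => /(_ r1).
Qed.

End UnionBounds.

(** * Growth of Brownian paths and finiteness of the limit *)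

Section BrownianGrowth.
Context {R : realType} d (T : measurableType d) (P : probability T R) (p : nat).
Variables (W : R -> T -> 'cV[R]_p) (eta : R).
Hypotheses (BM : std_BM P W) (eta0 : 0 < eta).

(** A polynomial tail makes the chaining sums geometric. The exponent q must satisfy
    [2 * (8/9)^q < 1], where 2 counts the new increments per level; 8 is enough. *)
Lemma expRN_le_inv_pow8 (z : R) : 0 < z -> expR (- z) <= (8 / z) ^+ 8.
Proof.
move=> z0; rewrite expRN -[leRHS]invrK lef_pV2 ?posrE ?expR_gt0 ?invr_gt0//; last first.
  by rewrite exprn_gt0// divr_gt0.
have {2}-> : z = 8%:R * (z / 8) by field.
rewrite -exprVn invf_div expRM_natl.
rewrite lerXn2r ?nnegrE ?expR_ge0 ?divr_ge0 ?(ltW z0)//.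
by rewrite (le_trans _ (expR_ge1Dx _))//; lra.
Qed.

Lemma BM_increment_tail (a : 'I_p) (s t x : R) : 0 <= s < t -> 0 < x ->
  (P [set w | (x < `|W t w a ord0 - W s w a ord0|)%R] <=
     (2 * (32 * (t - s) / x ^+ 2) ^+ 8)%:E)%E.
Proof.
move=> /andP[s0 st] x0; have [_ _ _ H] := BM.
pose ts (k : 'I_2) := if k == ord0 then s else t.
have [||_ law] := H 1%N ts => //.
  by move=> k; rewrite (ord1 k).
pose B := [set y : R | x < `|y|].
have mB : measurable B.
  rewrite -[X in measurable X]setTI.
  exact: (measurable_fun_ltr (measurable_cst x) (@normr_measurable _ _)).
have ts0 : 0 < t - s by rewrite subr_gt0.
have := law (ord0, a) B mB; rewrite /ts /= => E.
rewrite [X in (X <= _)%E](_ : _ = normal_prob 0 (Num.sqrt (t - s)) B)//.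
rewrite (le_trans (normal_prob_tail _ (ltW x0))) ?sqrtr_gt0// lee_fin ler_wpM2l//.
have z0 : 0 < x ^+ 2 / (4 * (t - s)) by rewrite divr_gt0 ?exprn_gt0 ?mulr_gt0.
rewrite sqr_sqrtr ?(ltW ts0)// (le_trans (expRN_le_inv_pow8 z0))//.
by rewrite le_eqVlt; apply/orP; left; apply/eqP; congr (_ ^+ 8); field; rewrite !gt_eqF.
Qed.

Definition dyadic (n l k : nat) : R := 2 ^+ n * k%:R / 2 ^+ l.

(** Factor gained by [t^(1/2 + eta)] when [t] doubles. *)
Definition growth : R := powR 2 (1 / 2 + eta).

(** The thresholds [(3/4)^l] are summable along a chain, yet large enough that variance over squared
    threshold, [2^-l / (3/4)^(2 l) = (8/9)^l] in its dependence on l, still tends to 0. *)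
Definition large_increment (a : 'I_p) (lam : R) (n l : nat) : set T :=
  [set w | exists k : 'I_(2 ^ l), lam * growth ^+ n * (3 / 4) ^+ l <
     `|W (dyadic n l k.+1) w a ord0 - W (dyadic n l k) w a ord0|].

Lemma growth_gt0 : 0 < growth. Proof. exact: powR_gt0. Qed.

Lemma growth_sqr : 2 / growth ^+ 2 < 1.
Proof.
rewrite ltr_pdivrMr ?exprn_gt0 ?growth_gt0// mul1r /growth -powR_mulrn ?powR_ge0//.
rewrite -powRrM -[ltLHS]powRr1// /powR gt_eqF// ltr_expR ltr_pM2r ?ln_gt0 ?ltr1n//.
by rewrite mulrDl div1r mulVf// ltrDl mulr_gt0.
Qed.

Lemma measurable_large_increment a lam n l : measurable (large_increment a lam n l).
Proof.
have [mW _ _ _] := BM; apply: measurable_exists_fin => k.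
apply: measurable_lt_cst; apply: (measurableT_comp (@normr_measurable R setT)).
exact: measurable_funB.
Qed.

Lemma large_increment_prob a (lam : R) n l : 0 < lam ->
  (P (large_increment a lam n l) <=
    (2 * (32 / lam ^+ 2) ^+ 8 * ((2 / growth ^+ 2) ^+ 8) ^+ n *
      (2 * (8 / 9) ^+ 8) ^+ l)%:E)%E.
Proof.
move=> lam0; have [mW _ _ _] := BM; have g0 := growth_gt0.
pose c : R := 2 * (32 / lam ^+ 2 * (2 / growth ^+ 2) ^+ n * (8 / 9) ^+ l) ^+ 8.
have -> : 2 * (32 / lam ^+ 2) ^+ 8 * ((2 / growth ^+ 2) ^+ 8) ^+ n *
    (2 * (8 / 9) ^+ 8) ^+ l = #|'I_(2 ^ l)|%:R * c.
  rewrite card_ord natrX (exprMn l 2) mulrCA; congr (_ * _).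
  by rewrite -!exprM !(mulnC 8) !exprM /c !exprMn !mulrA.
apply: finite_union_bound => k.
  apply: measurable_lt_cst; apply: (measurableT_comp (@normr_measurable R setT)).
  exact: measurable_funB.
have l0 : 0 < (2 : R) ^+ l by rewrite exprn_gt0.
have n0 : 0 < (2 : R) ^+ n by rewrite exprn_gt0.
have gn0 : 0 < growth ^+ n by rewrite exprn_gt0.
have q0 : 0 < (3 / 4 : R) ^+ l by rewrite exprn_gt0// divr_gt0.
have dE : dyadic n l k.+1 - dyadic n l k = 2 ^+ n / 2 ^+ l.
  by rewrite /dyadic -mulrBl -mulrBr -natrB// subSnn mulr1.
have x0 : 0 < lam * growth ^+ n * (3 / 4) ^+ l by rewrite !mulr_gt0.
have st : 0 <= dyadic n l k < dyadic n l k.+1.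
  by rewrite -(subr_gt0 (dyadic _ _ _)) dE divr_gt0// andbT divr_ge0// mulr_ge0.
have /le_trans := @BM_increment_tail a _ _ _ st x0.
apply; rewrite dE lee_fin le_eqVlt; apply/orP; left; apply/eqP.
rewrite /c; congr (2 * _ ^+ 8).
have -> : (2 / growth ^+ 2) ^+ n = 2 ^+ n / (growth ^+ n) ^+ 2.
  by rewrite expr_div_n -!exprM mulnC.
have -> : (8 / 9 : R) ^+ l = (2 ^+ l)^-1 / ((3 / 4) ^+ l) ^+ 2.
  rewrite (_ : (8 / 9 : R) = 2^-1 / (3 / 4) ^+ 2); last by field.
  by rewrite expr_div_n exprVn -!exprM mulnC.
move: l0 n0 gn0 q0; move: (2 ^+ n) (2 ^+ l) (growth ^+ n) ((3 / 4) ^+ l).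
by move=> N L G Q L0 N0 G0 Q0; field; rewrite !gt_eqF.
Qed.

Definition wild (a : 'I_p) (lam : R) : set T :=
  \bigcup_n \bigcup_l large_increment a lam n l.

Lemma measurable_wild a lam : measurable (wild a lam).
Proof.
apply: bigcupT_measurable => n; apply: bigcupT_measurable => l.
exact: measurable_large_increment.
Qed.

Lemma wild_prob : exists2 C : R, 0 <= C & forall a (lam : R), 1 <= lam ->
  (P (wild a lam) <= (C / lam)%:E)%E.
Proof.
have g0 := growth_gt0; have g1 := growth_sqr.
have q0 : 0 < 2 / growth ^+ 2 by rewrite divr_gt0 ?exprn_gt0.
pose r1 := (2 / growth ^+ 2) ^+ 8; pose r2 : R := 2 * (8 / 9) ^+ 8.
have r101 : 0 < r1 < 1 by rewrite exprn_gt0//= exprn_ilt1// ltW.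
have r201 : 0 < r2 < 1.
  by apply/andP; split; [rewrite mulr_gt0// exprn_gt0// divr_gt0|rewrite /r2; lra].
have r1_0 : 0 < 1 - r1 by rewrite subr_gt0; case/andP: r101.
have r2_0 : 0 < 1 - r2 by rewrite subr_gt0; case/andP: r201.
exists (2 * 32 ^+ 8 / (1 - r2) / (1 - r1)).
  by rewrite !divr_ge0 ?mulr_ge0 ?exprn_ge0 ?ltW.
move=> a lam lam1; have lam0 : 0 < lam by rewrite (lt_le_trans ltr01).
pose c := 2 * (32 / lam ^+ 2) ^+ 8.
have c0 : 0 <= c by rewrite mulr_ge0 ?exprn_ge0 ?divr_ge0 ?exprn_ge0 ?ltW.
apply: (@le_trans _ _ (c / (1 - r2) / (1 - r1))%:E).
  apply: geometric_union_bound => //; first by rewrite divr_ge0// ltW.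
    by move=> n; apply: bigcupT_measurable => l; exact: measurable_large_increment.
  move=> n; rewrite mulrAC; apply: geometric_union_bound => //.
  - by rewrite mulr_ge0// exprn_ge0// ltW//; case/andP: r101.
  - by move=> l; exact: measurable_large_increment.
  - by move=> l; exact: large_increment_prob.
rewrite lee_fin /c expr_div_n mulrA.
rewrite (_ : _ / (1 - r1) / lam = 2 * 32 ^+ 8 / lam / (1 - r2) / (1 - r1)); last by ring.
rewrite !ler_wpM2r ?invr_ge0 ?(ltW r1_0) ?(ltW r2_0)//.
(* Of the available decay [lam^-16] only [lam^-1] is kept. *)
rewrite ler_wpM2l ?mulr_ge0 ?exprn_ge0// lef_pV2 ?posrE ?exprn_gt0//.
by rewrite -exprM -[leLHS]expr1 ler_weXn2l.
Qed.

Lemma dyadic_bound (V : R -> R) (lam : R) n : V 0 = 0 -> 0 <= lam ->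
  (forall l k, (k < 2 ^ l)%N ->
     `|V (dyadic n l k.+1) - V (dyadic n l k)| <= lam * (3 / 4) ^+ l) ->
  forall l k, (k <= 2 ^ l)%N -> `|V (dyadic n l k)| <= 4 * lam.
Proof.
move=> V0 lam0 H.
(* [4 - 3 * (3/4)^l] is the sum of [(3/4)^i] for i up to l. An odd point of level l + 1 is one
   increment to the right of a point of level l, so each level adds one term. *)
suff S l : forall k, (k <= 2 ^ l)%N ->
    `|V (dyadic n l k)| <= lam * (4 - 3 * (3 / 4) ^+ l).
  move=> l k kl; rewrite (le_trans (S l k kl))// mulrC ler_wpM2r//.
  by rewrite gerBl mulr_ge0// exprn_ge0// divr_ge0.
elim: l => [|l IH] k kl.
  have {kl} : k = 0%N \/ k = 1%N by case: k kl => [|[|]]; [left|right|].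
  rewrite expr0 (_ : 4 - 3 * 1 = 1 :> R); last by lra.
  case=> ->; first by rewrite /dyadic mulr0 mul0r V0 normr0 mulr1.
  have := H 0%N 0%N isT.
  by rewrite {2}/dyadic mulr0 mul0r V0 subr0.
have q0 : 0 <= (3 / 4 : R) ^+ l by rewrite exprn_ge0// divr_ge0.
have evenE i : dyadic n l.+1 i.*2 = dyadic n l i.
  rewrite /dyadic -muln2 natrM exprS invfM; field.
  by rewrite expf_neq0.
have IH' i : (i <= 2 ^ l)%N ->
    `|V (dyadic n l i)| <= lam * (4 - 3 * (3 / 4) ^+ l.+1) - lam * (3 / 4) ^+ l.+1.
  move=> il; rewrite (le_trans (IH i il))// -mulrBr ler_wpM2l// exprS; lra.
have ql0 : 0 <= lam * (3 / 4) ^+ l.+1 by rewrite mulr_ge0// exprn_ge0// divr_ge0.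
have [i [ki|ki]] : exists i, k = i.*2 \/ k = i.*2.+1.
    exists k./2; case: (boolP (odd k)) => ok; [right|left];
      by rewrite -[LHS]odd_double_half ?ok ?(negbTE ok).
  rewrite ki evenE; apply: (le_trans (IH' i _)); last by rewrite gerBl.
  by rewrite -leq_double -ki -mul2n -expnS.
have il : (i.*2 < 2 ^ l.+1)%N by rewrite -ki.
have := H l.+1 i.*2 il; rewrite -ki evenE => Hk.
have il' : (i <= 2 ^ l)%N by rewrite -leq_double -[(2 ^ l).*2]mul2n -expnS ltnW.
rewrite -(subrK (V (dyadic n l i)) (V (dyadic n l.+1 k))).
rewrite (le_trans (ler_normD _ _))//.
rewrite -lerBrDl (le_trans (IH' i il'))//; lra.
Qed.

Lemma cvg_dyadic n (t : R) : 0 <= t <= 2 ^+ n ->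
  (fun l => dyadic n l (Num.truncn (t * 2 ^+ l / 2 ^+ n))) @ \oo --> t.
Proof.
move=> /andP[t0 tn].
have n0 : 0 < (2 : R) ^+ n by rewrite exprn_gt0.
apply: (@squeeze_cvgr _ _ _ _ (fun l => t - geometric (2 ^+ n) 2^-1 l) (cst t)).
- apply: nearW => l /=.
  have l0 : 0 < (2 : R) ^+ l by rewrite exprn_gt0.
  have x0 : 0 <= t * 2 ^+ l / 2 ^+ n by rewrite divr_ge0 ?mulr_ge0 ?(ltW l0) ?(ltW n0).
  have /andP[h1 h2] := truncn_itv x0; rewrite /dyadic; apply/andP; split.
    rewrite exprVn ler_pdivlMr// mulrBl divfK ?gt_eqF//.
    by move: h2; rewrite ltr_pdivrMr// -natr1; lra.
  by rewrite ler_pdivrMr// mulrC -ler_pdivlMr.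
- rewrite -[X in _ --> X]subr0; apply: cvgB; first exact: cvg_cst.
  by apply: cvg_geometric; rewrite ger0_norm// invf_lt1// ltr1n.
- exact: cvg_cst.
Qed.

Lemma dyadic_scale (t : R) : 1 <= t -> exists n, t <= 2 ^+ n <= 2 * t.
Proof.
move=> t1; have ex : exists n, t <= 2 ^+ n.
  exists (Num.truncn t).+1; rewrite (le_trans (ltW (truncnS_gt t)))//.
  by rewrite -natrX ler_nat ltnW// ltn_expl.
have [n tn nmin] := ex_minnP ex; exists n; rewrite tn /=.
case: n tn nmin => [|n] tn nmin; first by rewrite expr0; lra.
rewrite exprS ler_pM2l// leNgt; apply/negP => nt.
by have := nmin n (ltW nt); rewrite ltnn.
Qed.

Lemma tame_growth a lam w (t : R) : 0 <= lam -> ~ wild a lam w -> 1 <= t ->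
  `|W t w a ord0| <= 4 * lam * growth * powR t (1 / 2 + eta).
Proof.
move=> lam0 tame t1; have [_ W0 cW _] := BM; have g0 := growth_gt0.
have [n /andP[tn nt]] := dyadic_scale t1.
have t0 : 0 < t by rewrite (lt_le_trans ltr01).
have n0 : 0 < (2 : R) ^+ n by rewrite exprn_gt0.
have lg0 : 0 <= lam * growth ^+ n by rewrite mulr_ge0// exprn_ge0// ltW.
have V0 : W 0 w a ord0 = 0 by rewrite W0 mxE.
have D := @dyadic_bound (fun t => W t w a ord0) _ n V0 lg0.
have {D}/D H l k : (k < 2 ^ l)%N ->
    `|W (dyadic n l k.+1) w a ord0 - W (dyadic n l k) w a ord0| <=
    lam * growth ^+ n * (3 / 4) ^+ l.
  move=> kl; rewrite leNgt; apply/negP => Hk; apply: tame.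
  by exists n => //; exists l => //; exists (Ordinal kl).
have : `|W t w a ord0| <= 4 * (lam * growth ^+ n).
  have tn' : 0 <= t <= 2 ^+ n by rewrite ltW.
  apply: (@ler_cvg_to _ _ _ _ _ _ _ _
    (cvg_norm (cvg_path (V := fun t => W t w a ord0) (cW w a) t0 (cvg_dyadic tn')))
    (cvg_cst _)).
  apply: nearW => l /=; apply: H.
  rewrite truncn_le_nat (@le_lt_trans _ _ ((2 ^ l)%:R))// ?ltr_nat//.
  by rewrite ler_pdivrMr// natrX mulrC ler_wpM2l// exprn_ge0.
(* From [2^n <= 2 t] follows [growth^n <= growth * t^(1/2 + eta)], the origin of the extra factor
   [growth]. *)
move/le_trans; apply; rewrite -!mulrA !ler_wpM2l//.
rewrite /growth -powR_mulrn ?powR_ge0// -powRrM mulrC powRrM powR_mulrn//.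
rewrite -powRM ?(ltW t0)//; apply: ge0_ler_powR; rewrite ?nnegrE ?(ltW n0)//.
- by rewrite addr_ge0 ?(ltW eta0).
- by rewrite mulr_ge0 ?(ltW t0).
Qed.

Lemma normM1_le (v : 'cV[R]_p) (c : R) : 0 <= c ->
  (forall a, `|v a ord0| <= c) -> normM 1%:M v <= c.
Proof.
move=> c0 vc; rewrite normM1E.
have [->|p0] := eqVneq (Num.sqrt (p%:R : R)) 0; first by rewrite invr0 mulr0.
have sp0 : 0 < Num.sqrt (p%:R : R) by rewrite lt_neqAle eq_sym p0 sqrtr_ge0.
rewrite ler_pdivrMr// -[leRHS]ger0_norm ?mulr_ge0 ?(ltW sp0)//.
rewrite -sqrtr_sqr ler_wsqrtr// exprMn sqr_sqrtr// mulr_natr.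
rewrite -[X in _ *+ X]card_ord -sumr_const; apply: ler_sum => i _.
by rewrite -real_normK ?num_real// lerXn2r ?nnegrE.
Qed.

(** Both [t W(s)] and [s W(t)] are at most [c t^(3/2 + eta)] in each coordinate, exactly what the
    weight compensates. *)
Lemma contrast_bounded w (c : R) : 0 <= c ->
  (forall a t, 1 <= t -> `|W t w a ord0| <= c * powR t (1 / 2 + eta)) ->
  forall s t, 1 <= s <= t -> contrast eta W s t w <= 2 * c.
Proof.
move=> c0 H s t /andP[s1 st]; have t1 : 1 <= t := le_trans s1 st.
have t0 : 0 < t by rewrite (lt_le_trans ltr01).
have s0 : 0 < s by rewrite (lt_le_trans ltr01).
set k := 1 / 2 + eta; have k0 : 0 <= k by rewrite addr_ge0 ?(ltW eta0).
have tk0 : 0 <= powR t k := powR_ge0 _ _.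
have sk : powR s k <= powR t k by apply: ge0_ler_powR; rewrite ?nnegrE ?(ltW s0) ?(ltW t0).
rewrite (@le_trans _ _ (powR t (- (3 / 2) - eta) * (2 * c * (t * powR t k))))//.
  rewrite ler_wpM2l ?powR_ge0//; apply: normM1_le.
    by rewrite mulr_ge0 ?mulr_ge0 ?(ltW t0).
  move=> a; rewrite !mxE (le_trans (ler_normB _ _))// !normrM (gtr0_norm t0) (gtr0_norm s0).
  have h1 := H a s s1; have h2 := H a t t1.
  have h3 : t * `|W s w a ord0| <= t * (c * powR t k).
    rewrite ler_pM2l// (le_trans h1)// ler_wpM2l//.
  have h4 : s * `|W t w a ord0| <= t * (c * powR t k).
    by apply: ler_pM => //; exact: ltW.
  by rewrite (le_trans (lerD h3 h4))//; lra.
rewrite mulrC -[leRHS]mulr1 -!mulrA !ler_wpM2l// -{1}(powRr1 (ltW t0)).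
rewrite -!powRD; [|by rewrite (gt_eqF t0) ?implybT..].
by rewrite (_ : 1 + _ = 0) ?powRr0// /k; lra.
Qed.

Lemma measurable_Lpeta_le (y : R) : measurable [set w | (Lpeta W eta w <= y%:E)%E].
Proof.
have [mW _ cW _] := BM; rewrite -lim_sup_grid_event//.
apply: bigcapT_measurable => n; apply: bigcup_measurable => j _.
apply: measurable_grid_event => i a; under eq_fun do rewrite mxE.
by apply: measurable_funM.
Qed.

Lemma Lpeta_ge0 w : (0 <= Lpeta W eta w)%E.
Proof.
rewrite (@le_trans _ _ (contrast eta W 1 1 w)%:E)//.
  by rewrite lee_fin contrast_ge0.
by apply: ereal_sup_ubound; exists 1, 1; rewrite lexx.
Qed.

(** An infinite supremum forces, for every N, some coordinate to be wild at level N + 1, which has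
    probability at most [p C / (N + 1)]. *)
Lemma Lpeta_finite : P [set w | Lpeta W eta w = +oo%E] = 0%E.
Proof.
have mL : measurable [set w | Lpeta W eta w = +oo%E].
  rewrite (_ : [set _ | _] = \bigcap_N ~` [set w | (Lpeta W eta w <= N%:R%:E)%E]).
    by apply: bigcapT_measurable => N; apply: measurableC; exact: measurable_Lpeta_le.
  apply/seteqP; split => w /=; first by move=> Loo N _ /=; rewrite Loo leye_eq.
  move=> H; have := Lpeta_ge0 w; case E : (Lpeta W eta w) => [r||] //= _.
  exfalso; apply: (H (Num.truncn r).+1 I) => /=.
  by rewrite E lee_fin ltW// truncnS_gt.
have [C C0 HC] := wild_prob.
have bound N : (P [set w | Lpeta W eta w = +oo%E] <= (p%:R * (C / N.+1%:R))%:E)%E.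
  have N1 : 1 <= N.+1%:R :> R by rewrite ler1n.
  have := @finite_union_bound _ _ _ P _ (fun a : 'I_p => wild a N.+1%:R) (C / N.+1%:R)
    (fun a => measurable_wild a _) (fun a => HC a _ N1).
  rewrite card_ord; apply: le_trans; apply: le_measure; rewrite ?inE//.
    by apply: measurable_exists_fin => a; exact: measurable_wild.
  move=> w /= Loo; apply: contrapT => tame.
  have c0 : 0 <= 4 * N.+1%:R * growth by rewrite !mulr_ge0// ltW// growth_gt0.
  have := contrast_bounded c0 (fun a t => @tame_growth a N.+1%:R w t (ler0n _ _)
     (fun wa => tame (ex_intro _ a wa))).
  by move/Lpeta_leP; rewrite Loo leye_eq.
apply/eqP; rewrite eq_le measure_ge0 andbT; apply/lee_addgt0Pr => e e0; rewrite add0e.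
rewrite (le_trans (bound (Num.truncn (p%:R * C / e))))// lee_fin mulrA ler_pdivrMr//.
by rewrite -ler_pdivrMl// mulrC ltW// truncnS_gt.
Qed.

End BrownianGrowth.

(** * Pathwise comparison of the statistic with its Gaussian counterpart *)

Section PathwiseComparison.
Context {R : realType} {p : nat} (T : Type).
Variables (eta xi : R) (H : 'M[R]_p).
Hypotheses (eta0 : 0 < eta) (xi01 : 0 < xi < 1 / 2) (Hunit : H \in unitmx).
Variables (Y : nat -> T -> 'cV[R]_p) (mu : 'cV[R]_p).

Definition csum (j : nat) (w : T) : 'cV[R]_p := \sum_(1 <= i < j.+1) (Y i w - mu).

Lemma Ybar_diff j k w : (0 < j < k)%N ->
  (j * (k - j))%:R *: (Ybar Y 1 j w - Ybar Y j.+1 k w) =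
  k%:R *: csum j w - j%:R *: csum k w.
Proof.
move=> /andP[j0 jk]; rewrite /Ybar /csum.
rewrite (_ : (j - 1 + 1)%N = j); last by rewrite subnK.
rewrite (_ : (k - j.+1 + 1)%N = (k - j)%N); last by rewrite addn1 subnSK.
rewrite (@big_cat_nat _ _ _ j.+1 1 k.+1)//=; last by rewrite ltnS ltnW.
rewrite !sumrB !sumr_const_nat !subSS subn0.
have dE : k%:R = j%:R + (k - j)%:R :> R by rewrite -natrD subnKC// ltnW.
have d0 : (k - j)%:R != 0 :> R by rewrite pnatr_eq0 subn_eq0 -ltnNge.
have j0' : j%:R != 0 :> R by rewrite pnatr_eq0 -lt0n.
apply/colP => a; rewrite natrM dE !mxE !mulmxnE -!(mulr_natr (mu a 0)).
move: d0 j0'; move: (\sum_(1 <= i < _) _) (\sum_(j.+1 <= i < _) _) => A B.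
by move: (k - j)%:R (j%:R) => D J D0 J0; field; rewrite D0 J0.
Qed.

Definition stat_term (A : 'M[R]_p) m j k w : R :=
  powR (m%:R / k%:R) (3 / 2 + eta) * ((j * (k - j))%:R / powR m%:R (3 / 2) *
     normM (invmx A) (Ybar Y 1 j w - Ybar Y j.+1 k w)).

Lemma stat_termE A m j k w : (0 < j < k)%N ->
  stat_term A m j k w = powR (m%:R / k%:R) (3 / 2 + eta) / powR m%:R (3 / 2) *
     normM (invmx A) (k%:R *: csum j w - j%:R *: csum k w).
Proof.
move=> jk; rewrite -Ybar_diff// normMZ ger0_norm// /stat_term; ring.
Qed.

(** The left side equals [m^eta k^-(1/2 + eta - xi)]; the exponent of k is negative since
    [xi < 1/2], so [k = m] is the worst case. *)
Lemma weight_bound (m k : nat) : (0 < m)%N -> (m <= k)%N ->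
  powR (m%:R / k%:R) (3 / 2 + eta) / powR m%:R (3 / 2) * (k%:R * powR k%:R xi) <=
  powR m%:R (xi - 1 / 2) :> R.
Proof.
move=> m0 mk; have k0 : (0 < k)%N by exact: leq_trans mk.
have m0' : 0 < m%:R :> R by rewrite ltr0n.
have k0' : 0 < k%:R :> R by rewrite ltr0n.
case/andP: xi01 => xi0 xi1; have eta_gt0 := eta0.
rewrite (_ : _ * (_ * _) = powR m%:R eta * powR k%:R (- (1 / 2 + eta - xi))).
  rewrite (_ : xi - 1 / 2 = eta + - (1 / 2 + eta - xi)); last by lra.
  rewrite powRD ?(gt_eqF m0') ?implybT// ler_wpM2l ?powR_ge0//.
  rewrite !powRN lef_pV2 ?posrE ?powR_gt0//.
  by apply: ge0_ler_powR; rewrite ?nnegrE ?ler0n ?ler_nat//; lra.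
have mD : powR m%:R (3 / 2 + eta) = powR m%:R (3 / 2) * powR m%:R eta :> R.
  by rewrite powRD// (gt_eqF m0') implybT.
have kD : powR k%:R (- (1 / 2 + eta - xi)) =
    powR k%:R (- (3 / 2 + eta)) * (k%:R * powR k%:R xi) :> R.
  rewrite -{3}(powRr1 (ltW k0')) -!powRD; [|by rewrite (gt_eqF k0') ?implybT..].
  by congr powR; lra.
rewrite powRM ?invr_ge0// -{1}(powR_inv1 (ltW k0')) -powRrM mulN1r mD kD.
have := powR_gt0 (3 / 2) m0'; move: (powR m%:R (3 / 2)) (powR m%:R eta) => x y x0.
by rewrite mulrA [x * y * _]mulrAC -mulrA mulrC mulrA; field; rewrite gt_eqF.
Qed.

Lemma cmp_powR_le (a b : nat) : (a <= b)%N -> powR a%:R xi <= powR b%:R xi :> R.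
Proof.
move=> ab; case/andP: xi01 => xi0 _.
by apply: ge0_ler_powR; rewrite ?nnegrE ?ler0n ?ler_nat ?ltW.
Qed.

Variables (W1 W2 : R -> T -> 'cV[R]_p) (m : nat) (w : T) (K : R).
Hypotheses (m0 : (0 < m)%N) (K0 : 0 <= K) (W10 : W1 0 w = 0).
Hypothesis bound1 : forall k, (m < k)%N ->
  norm2 (\sum_(m.+1 <= i < k.+1) (Y i w - mu) - H *m W1 (k - m)%:R w) <=
  K * powR (k - m)%:R xi.
Hypothesis bound2 :
  norm2 (\sum_(1 <= i < m.+1) (Y i w - mu) - H *m W2 m%:R w) <= K * powR m%:R xi.

Definition glued (j : nat) : 'cV[R]_p := W2 m%:R w + W1 j%:R w.

Lemma csum_error j :
  norm2 (csum (m + j) w - H *m glued j) <= 2 * K * powR (m + j)%:R xi.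
Proof.
have b2 : norm2 (csum m w - H *m W2 m%:R w) <= K * powR (m + j)%:R xi.
  by rewrite (le_trans bound2)// ler_wpM2l// cmp_powR_le// leq_addr.
have Kp : 0 <= K * powR (m + j)%:R xi by rewrite mulr_ge0 ?powR_ge0.
(* [bound1] speaks of k > m only, so j = 0 rests on [bound2] and [W1 0 = 0]; for j > 0 the two
   bounds add up to the factor 2. *)
case: j Kp b2 => [|j] Kp b2.
  rewrite /glued W10 addr0 -mulrA mulr_natl; move: b2; rewrite addn0.
  by move/le_trans; apply; rewrite mulr2n lerDl; move: Kp; rewrite addn0.
have mj : (m < m + j.+1)%N by rewrite -addSnnS leq_addr.
have := bound1 mj; rewrite addKn => b1.
have {}b1 := le_trans b1 (ler_wpM2l K0 (cmp_powR_le (leq_addl m j.+1))).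
rewrite /csum (@big_cat_nat _ _ _ m.+1)//= -/(csum m w); last by rewrite ltnW.
rewrite /glued mulmxDr opprD addrACA (le_trans (norm2D _ _))//.
by rewrite (le_trans (lerD b2 b1))//; lra.
Qed.

(** The 4 is two partial sums with error [2 K] each; [frob (invmx H)] is the price of moving the
    error inside [H]. *)
Definition sandwich_error : R :=
  4 * frob (invmx H) / Num.sqrt p%:R * K * powR m%:R (xi - 1 / 2).

Lemma stat_term_sandwich (A : 'M[R]_p) (r : R) j k : (j < k)%N -> 0 < r < 1 ->
  (forall u, (1 - r) * normM 1%:M u <= normM (invmx A) (H *m u)
             <= (1 + r) * normM 1%:M u) ->
  (1 - r) * (grid_term eta m (m + j) (m + k) (glued j) (glued k) - sandwich_error) <=
    stat_term A m (m + j) (m + k) w <=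
  (1 + r) * (grid_term eta m (m + j) (m + k) (glued j) (glued k) + sandwich_error).
Proof.
move=> jk /andP[r0 r1] HA; set g := grid_term _ _ _ _ _ _; set e := sandwich_error.
have jk' : (0 < m + j < m + k)%N by rewrite addn_gt0 m0 ltn_add2l.
have mk : (m <= m + k)%N by rewrite leq_addr.
rewrite stat_termE//; set c := powR _ _ / powR _ _.
have c0 : 0 <= c by rewrite divr_ge0 ?powR_ge0.
pose err i := csum (m + i) w - H *m glued i.
pose v := (m + k)%:R *: glued j - (m + j)%:R *: glued k.
pose f := invmx H *m ((m + k)%:R *: err j - (m + j)%:R *: err k).
(* Factoring [H] out of Gaussian part and error together lets the matrix comparison [HA] act on
   their sum. *)
have -> : (m + k)%:R *: csum (m + j) w - (m + j)%:R *: csum (m + k) w = H *m (v + f).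
  rewrite mulmxDr (mulKVmx Hunit) /v /err mulmxBr -!scalemxAr !scalerBr.
  by rewrite opprB addrACA addKr addrCA subrr addr0.
have xik : powR (m + j)%:R xi <= powR (m + k)%:R xi :> R.
  by rewrite cmp_powR_le// leq_add2l ltnW.
have jk'' : (m + j)%:R <= (m + k)%:R :> R by rewrite ler_nat leq_add2l ltnW.
have fe : c * normM 1%:M f <= e.
  rewrite normM1E /e /sandwich_error.
  have h : norm2 ((m + k)%:R *: err j - (m + j)%:R *: err k) <=
      4 * K * ((m + k)%:R * powR (m + k)%:R xi).
    rewrite (le_trans (norm2B _ _))// !norm2Z !ger0_norm//.
    have h1 : (m + k)%:R * norm2 (err j) <= (m + k)%:R * (2 * K * powR (m + k)%:R xi).
      by rewrite ler_wpM2l// (le_trans (csum_error j))// ler_wpM2l// mulr_ge0.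
    have h2 : (m + j)%:R * norm2 (err k) <= (m + k)%:R * (2 * K * powR (m + k)%:R xi).
      by apply: ler_pM => //; [exact: norm2_ge0|exact: csum_error].
    by rewrite (le_trans (lerD h1 h2))//; lra.
  have h3 := le_trans (norm2_mulmx (invmx H) _) (ler_wpM2l (frob_ge0 (invmx H)) h).
  have sp : 0 <= (Num.sqrt p%:R)^-1 :> R by rewrite invr_ge0 sqrtr_ge0.
  rewrite (le_trans (ler_wpM2l c0 (ler_wpM2r sp h3)))//.
  have := weight_bound m0 mk; rewrite -/c => wb.
  rewrite (_ : c * _ = 4 * frob (invmx H) / Num.sqrt p%:R * K *
    (c * ((m + k)%:R * powR (m + k)%:R xi))); last by ring.
  by rewrite ler_wpM2l// !mulr_ge0// ?frob_ge0.
have normMD (x y : 'cV[R]_p) : normM 1%:M (x + y) <= normM 1%:M x + normM 1%:M y.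
  by rewrite !normM1E -mulrDl ler_wpM2r ?invr_ge0 ?sqrtr_ge0// norm2D.
have normMDl (x y : 'cV[R]_p) : normM 1%:M x - normM 1%:M y <= normM 1%:M (x + y).
  by rewrite !normM1E -mulrBl ler_wpM2r ?invr_ge0 ?sqrtr_ge0// ler_norm2B.
have gE : g = c * normM 1%:M v by [].
have /andP[HA1 HA2] := HA (v + f).
apply/andP; split.
  apply: le_trans (ler_wpM2l c0 HA1).
  rewrite mulrCA ler_wpM2l//; first by lra.
  by rewrite gE (le_trans _ (ler_wpM2l c0 (normMDl v f)))// mulrBr lerB.
apply: le_trans (ler_wpM2l c0 HA2) _.
rewrite mulrCA ler_wpM2l//; first by lra.
by rewrite gE (le_trans (ler_wpM2l c0 (normMD v f)))// mulrDr lerD.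
Qed.

End PathwiseComparison.

(** * Passage from grid probabilities to the limit law *)

Section LimitLaw.
Context {R : realType} {p : nat} (eta : R).

Lemma glued_grid_law d (T : measurableType d) d' (T' : measurableType d')
    (P : probability T R) (P' : probability T' R)
    (W1 W2 : R -> T -> 'cV[R]_p) (W : R -> T' -> 'cV[R]_p) (m : nat) (y : R) :
  std_BM P W1 -> std_BM P W2 -> indep_processes P W1 W2 -> std_BM P' W -> (0 < m)%N ->
  P (grid_event eta m y (fun j w => glued W1 W2 m w j)) =
  P' (grid_event eta m y (scaled_grid W m)).
Proof.
move=> BM1 BM2 W12 BM m0.
have [mW1 _ _ _] := BM1; have [mW2 _ _ _] := BM2; have [mW _ _ _] := BM.
apply: grid_event_law.
- by move=> j a; under eq_fun do rewrite mxE; exact: measurable_funD.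
- by move=> j a; under eq_fun do rewrite mxE; exact: measurable_funM.
move=> n B mB; apply: (eq_trans (glued_BM_increments BM1 BM2 W12 m0 mB)).
by apply/esym; exact: scaled_BM_increments.
Qed.

(** Squeeze: each grid event contains [Lpeta <= y] and lies in the union of the later ones, whose
    probabilities decrease to that of the limsup. *)
Lemma cvg_grid_event_prob d (T : measurableType d) (P : probability T R)
    (W : R -> T -> 'cV[R]_p) (y : R) :
  std_BM P W ->
  (fun m => fine (P (grid_event eta m.+1 y (scaled_grid W m.+1)))) @ \oo -->
  fine (P [set w | (Lpeta W eta w <= y%:E)%E]).
Proof.
move=> BM; have [mW _ cW _] := BM.
have mL := measurable_Lpeta_le eta BM y.
pose E m := grid_event eta m.+1 y (scaled_grid W m.+1).
have mE m : measurable (E m).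
  by apply: measurable_grid_event => i a; under eq_fun do rewrite mxE; exact: measurable_funM.
have mU n : measurable (\bigcup_(k >= n) E k) by apply: bigcup_measurable.
apply: fine_cvg; rewrite fineK; last exact: fin_num_measure.
apply: (@squeeze_cvge _ _ _ _ (cst (P [set w | (Lpeta W eta w <= y%:E)%E])) _
  (fun n => P (\bigcup_(k >= n) E k))).
- apply: nearW => n; apply/andP; split; apply: le_measure; rewrite ?inE.
  + exact: mL.
  + exact: mE.
  + exact: Lpeta_le_grid_event.
  + exact: mE.
  + exact: mU.
  + by move=> w Ew; exists n => /=.
- exact: cvg_cst.
- rewrite -lim_sup_grid_event//; apply: lim_sup_set_cvg => //.
  by rewrite (le_lt_trans (probability_le1 P (mU 0%N)))// ltry.
Qed.

(** [1 - r] and [1 + r] come from the estimated matrix, [d] from the strong approximation, [e] from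
    the exceptional event. *)
Lemma sandwich_cvg (F : R -> R) (Fm : R -> nat -> R) (pm : nat -> R) (x : R) :
  {for x, continuous F} -> (forall y, Fm y @ \oo --> F y) ->
  (forall e r d, 0 < e -> 0 < r < 1 -> 0 < d -> \forall m \near \oo,
     pm m <= Fm (x / (1 - r) + d) m + e /\ Fm (x / (1 + r) - d) m <= pm m + e) ->
  pm @ \oo --> F x.
Proof.
move=> cF FmF H; apply/cvgrPdist_le => e e0.
have e3 : 0 < e / 3 by rewrite divr_gt0.
have /cvgrPdist_le /(_ _ e3) /nbhs_ballP [t /= t0 Ht] := cF.
(* With [r <= 1/2] the factor moves [x] by at most [t/4]; together with the shift [t/4] the point
   stays in the ball of radius [t]. *)
pose r := Num.min (1 / 2) (t / (8 * (`|x| + 1))).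
have x1 : 0 < `|x| + 1 by rewrite ltr_wpDl.
have r0 : 0 < r by rewrite lt_min !divr_gt0// mulr_gt0.
have r2 : r <= 1 / 2 by rewrite ge_min lexx.
have rx : r * (8 * (`|x| + 1)) <= t by rewrite -ler_pdivlMr ?mulr_gt0// ge_min lexx orbT.
have rx0 : 0 <= r * `|x| by rewrite mulr_ge0// ltW.
have rx' : r * `|x| <= t / 8 by nra.
have d0 : 0 < t / 4 by rewrite divr_gt0.
have r01 : 0 < r < 1 by rewrite r0 /=; lra.
have yp : ball x t (x / (1 - r) + t / 4).
  rewrite /ball /= (_ : x - _ = - (x * r / (1 - r)) - t / 4); last first.
    by field; rewrite gt_eqF//; lra.
  rewrite (le_lt_trans (ler_normB _ _))// normrN (gtr0_norm d0) !normrM.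
  rewrite (gtr0_norm r0) normfV (@gtr0_norm _ (1 - r)); last by lra.
  have : `|x| * r / (1 - r) <= t / 4; last by lra.
  by rewrite ler_pdivrMr; [nra|lra].
have ym : ball x t (x / (1 + r) - t / 4).
  rewrite /ball /= (_ : x - _ = x * r / (1 + r) + t / 4); last first.
    by field; rewrite gt_eqF//; lra.
  rewrite (le_lt_trans (ler_normD _ _))// (gtr0_norm d0) !normrM.
  rewrite (gtr0_norm r0) normfV (@gtr0_norm _ (1 + r)); last by lra.
  have : `|x| * r / (1 + r) <= t / 4; last by lra.
  by rewrite ler_pdivrMr; [nra|lra].
have := Ht _ yp; have := Ht _ ym; rewrite /= !ler_norml => /andP[Fa Fb] /andP[Fc Fd].
have /cvgrPdist_le /(_ _ e3) N1 := FmF (x / (1 - r) + t / 4).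
have /cvgrPdist_le /(_ _ e3) N2 := FmF (x / (1 + r) - t / 4).
have N3 := H _ _ _ e3 r01 d0.
near=> m.
have [h1 h2] : pm m <= Fm (x / (1 - r) + t / 4) m + e / 3 /\
    Fm (x / (1 + r) - t / 4) m <= pm m + e / 3 by near: m.
have : `|F (x / (1 - r) + t / 4) - Fm (x / (1 - r) + t / 4) m| <= e / 3 by near: m.
have : `|F (x / (1 + r) - t / 4) - Fm (x / (1 + r) - t / 4) m| <= e / 3 by near: m.
rewrite !ler_norml => /andP[h3 h4] /andP[h5 h6].
clear - Fa Fb Fc Fd h1 h2 h3 h4 h5 h6 e0.
by apply/andP; split; lra.
Unshelve. all: by end_near. Qed.

End LimitLaw.

(** * Measurability of functionals of the indicator vectors *)

Section IndicatorFunctionals.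
Context {R : realType} (dd p : nat) d (T : measurableType d).
Variables (xs : 'I_p -> 'cV[R]_dd) (X : nat -> T -> 'cV[R]_dd).
Hypothesis mX : forall i l, measurable_fun setT (fun w => X i w l ord0).

Let ind i (j : 'I_p) w : bool := [forall l : 'I_dd, X i w l ord0 <= xs j l ord0].

Lemma measurable_ind i j : measurable [set w | ind i j w].
Proof.
rewrite (_ : [set _ | _] = [set w | forall l, X i w l ord0 <= xs j l ord0]).
  by apply: measurable_forall_fin => l; exact: measurable_le_cst.
by apply/seteqP; split => w /= /forallP.
Qed.

(* A functional of [Y_0 .. Y_(n-1)] factors through finitely many indicator patterns. *)
Lemma measurable_Y_functional n (g : ('I_n -> 'cV[R]_p) -> R) :
  measurable_fun setT (fun w => g (fun i : 'I_n => Yvec xs X i w)).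
Proof.
pose code w : {ffun 'I_n * 'I_p -> bool} := [ffun i : 'I_n * 'I_p => ind i.1 i.2 w].
pose Yc (c : {ffun 'I_n * 'I_p -> bool}) (i : 'I_n) : 'cV[R]_p :=
  \col_(j < p) (if c (i, j) then 1 else 0).
have YE w : (fun i : 'I_n => Yvec xs X i w) = Yc (code w).
  by apply/funext => i; apply/colP => j; rewrite !mxE ffunE.
move=> _ B mB; rewrite setTI.
rewrite (_ : _ @^-1` _ = [set w | exists c, [set w | B (g (Yc c)) /\ code w = c] w]).
  apply: measurable_exists_fin => c.
  have [Bc|nBc] := pselect (B (g (Yc c))).
    rewrite (_ : [set _ | _] = [set w | forall i : 'I_n * 'I_p, [set w | ind i.1 i.2 w = c i] w]).
      apply: measurable_forall_fin => i; case: (c i); first exact: measurable_ind.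
      rewrite (_ : [set _ | _] = ~` [set w | ind i.1 i.2 w]).
        by apply: measurableC; exact: measurable_ind.
      by apply/seteqP; split => w /=; [move=> ->|move/negP/negbTE].
    apply/seteqP; split => w /=; first by move=> [_ <-] i; rewrite ffunE.
    by move=> h; split => //; apply/ffunP => i; rewrite ffunE h.
  rewrite [X in measurable X](_ : _ = set0)//.
  by apply/seteqP; split => w //= [].
apply/seteqP; split => w /=; first by rewrite YE => Bw; exists (code w).
by move=> [c [Bc cE]]; rewrite YE cE.
Qed.

Lemma measurable_Yvec i a : measurable_fun setT (fun w => Yvec xs X i w a ord0).
Proof. exact: (@measurable_Y_functional i.+1 (fun y => y ord_max a ord0)). Qed.

Lemma measurable_estimator (Sm : nat -> T -> 'M[R]_p) m a b :
  (exists f : ('I_m -> 'cV[R]_p) -> 'M[R]_p,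
      forall w, Sm m w = f (fun i => Yvec xs X i.+1 w)) ->
  measurable_fun setT (fun w => Sm m w a b).
Proof.
move=> [f fE]; under eq_fun do rewrite fE.
(* The general lemma starts at [Y_0], the estimators at [Y_1]; [lift ord0] skips the first entry. *)
exact: (@measurable_Y_functional m.+1 (fun y => f (fun i => y (lift ord0 i)) a b)).
Qed.

Lemma measurable_stat_term eta (Sm : nat -> T -> 'M[R]_p) m j k :
  (exists f : ('I_m -> 'cV[R]_p) -> 'M[R]_p,
      forall w, Sm m w = f (fun i => Yvec xs X i.+1 w)) -> (m <= j < k)%N ->
  measurable_fun setT (fun w => stat_term eta (Yvec xs X) (Sm m w) m j k w).
Proof.
move=> [f fE] /andP[mj jk].
(* The statistic is evaluated on a deterministic sequence, with [point] as a dummy outcome; [inord]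
   is the identity on the indices up to k that occur. *)
pose g (y : 'I_k.+1 -> 'cV[R]_p) : R :=
  stat_term eta (fun i (_ : T) => y (inord i)) (f (fun i => y (inord i.+1))) m j k point.
rewrite (_ : (fun w => _) = (fun w => g (fun i : 'I_k.+1 => Yvec xs X i w))).
  exact: measurable_Y_functional.
apply/funext => w; rewrite /g /stat_term /Ybar.
have E i : (i <= k)%N -> Yvec xs X (@inord k i) w = Yvec xs X i w.
  by move=> ik; rewrite inordK.
have -> : f (fun i : 'I_m => Yvec xs X (@inord k i.+1) w) = Sm m w.
  rewrite fE; congr f; apply/funext => i; rewrite E//.
  by rewrite (leq_trans (ltn_ord i))// (leq_trans mj)// ltnW.
have S a b : (b <= k.+1)%N -> \sum_(a <= i < b) Yvec xs X (@inord k i) w =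
    \sum_(a <= i < b) Yvec xs X i w.
  move=> bk; apply: eq_big_nat => i /andP[_ ib]; rewrite E//.
  by rewrite -ltnS (leq_trans ib).
by rewrite !S// ltnS ltnW.
Qed.

End IndicatorFunctionals.

(** * The monitoring statistic as a countable family of inequalities *)

(** The condition [0 <= x] matches the default value 0 of the maximum in [Dmk]. *)
Lemma monitor_stat_leP (R : realType) (T : Type) p (Y : nat -> T -> 'cV[R]_p)
    (Sm : nat -> T -> 'M[R]_p) (eta : R) m w (x : R) : (0 < m)%N -> 0 <= x ->
  (monitor_stat Y Sm eta m w <= x%:E)%E <->
  forall j k, (m <= j < k)%N -> stat_term eta Y (Sm m w) m j k w <= x.
Proof.
move=> m0 x0; split=> [H j k /andP[mj jk]|H].
  have mk : (m < k)%N := leq_ltn_trans mj jk.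
  rewrite -lee_fin (le_trans _ H)//.
  apply: (@le_trans _ _ (powR (m%:R / k%:R) (3 / 2 + eta) * Dmk Y Sm m k w)%:E).
    rewrite lee_fin ler_wpM2l ?powR_ge0//.
    have := @le_bigmax_seq _ _ _ (index_iota m k) 0 j xpredT (fun j =>
      (j * (k - j))%:R / powR m%:R (3 / 2) *
        normM (invmx (Sm m w)) (Ybar Y 1 j w - Ybar Y j.+1 k w)).
    by rewrite mem_index_iota mj jk => /(_ isT isT).
  by apply: ereal_sup_ubound; exists k.
apply: ge_ereal_sup => _ [k /= mk <-]; rewrite lee_fin.
have a0 : 0 < powR (m%:R / k%:R : R) (3 / 2 + eta).
  by rewrite powR_gt0// divr_gt0// ltr0n// (ltn_trans m0).
rewrite mulrC -ler_pdivlMr// /Dmk big_seq_cond; apply: bigmax_le.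
  by rewrite divr_ge0// ltW.
move=> j; rewrite andbT mem_index_iota => mjk.
by rewrite ler_pdivlMr// mulrC; exact: H.
Qed.

Lemma monitor_stat_ge0 (R : realType) (T : Type) p (Y : nat -> T -> 'cV[R]_p)
    (Sm : nat -> T -> 'M[R]_p) (eta : R) m w :
  (0 <= monitor_stat Y Sm eta m w)%E.
Proof.
apply: (@le_trans _ _ (powR (m%:R / m.+1%:R) (3 / 2 + eta) * Dmk Y Sm m m.+1 w)%:E).
  by rewrite lee_fin mulr_ge0 ?powR_ge0// /Dmk bigmax_ge_id.
by apply: ereal_sup_ubound; exists m.+1 => /=.
Qed.

(** * Exceptional events and vanishing errors *)

Section BadEvents.
Context {R : realType} d (T : measurableType d) (P : probability T R).

Lemma measurable_sup_gt (f : nat -> T -> R) (D : set nat) (M : R) :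
  (forall k, measurable_fun setT (f k)) ->
  measurable [set w | (M%:E < ereal_sup [set (f k w)%:E | k in D])%E].
Proof.
move=> mf.
rewrite (_ : [set _ | _] = ~` [set w | forall k, D k -> f k w <= M]).
  apply: measurableC; apply: measurable_forall_nat => k.
  by apply: measurable_imply => _; exact: measurable_le_cst.
apply/seteqP; split => w /=.
  rewrite ltNge => /negP H1 H2; apply: H1.
  by apply: ge_ereal_sup => _ [k Dk <-]; rewrite lee_fin; exact: H2.
move=> H; rewrite ltNge; apply/negP => H2; apply: H => k Dk.
by rewrite -lee_fin (le_trans _ H2)//; apply: ereal_sup_ubound; exists k.
Qed.

Lemma measurable_residual p (Y : nat -> T -> 'cV[R]_p) (mu : 'cV[R]_p)
    (H : 'M[R]_p) (V : T -> 'cV[R]_p) a b :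
  (forall i c, measurable_fun setT (fun w => Y i w c ord0)) ->
  (forall c, measurable_fun setT (fun w => V w c ord0)) ->
  measurable_fun setT (fun w => norm2 (\sum_(a <= i < b) (Y i w - mu) - H *m V w)).
Proof.
move=> mY mV; apply: measurable_norm2 => c.
rewrite (_ : (fun w => _) =
    (fun w => \sum_(a <= i < b) (Y i w c ord0 - mu c ord0) - (H *m V w) c ord0)).
  apply: measurable_funB; last exact: measurable_mulmx.
  by apply: measurable_sum => i; exact: measurable_funB.
apply/funext => w; rewrite mxE [X in _ + X]mxE summxE; congr (_ - _).
by apply: eq_bigr => i _; rewrite mxE [X in _ + X]mxE.
Qed.

Lemma fine_prob_le_union (A B C : set T) (e : R) :
  measurable A -> measurable B -> measurable C -> A `<=` B `|` C ->
  (P C <= e%:E)%E -> fine (P A) <= fine (P B) + e.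
Proof.
move=> mA mB mC ABC PC.
rewrite -lee_fin EFinD !fineK; [|exact: fin_num_measure..].
apply: (@le_trans _ _ (P (B `|` C))).
  by apply: le_measure; rewrite ?inE//; exact: measurableU.
exact: le_trans (measureU2 _ mB mC) (leeD (lexx _) PC).
Qed.

Lemma powR_neg_small (C k e : R) : 0 <= C -> 0 < k -> 0 < e ->
  \forall m \near \oo, C * powR m%:R (- k) <= e.
Proof.
move=> C0 k0 e0; near=> m.
have m0 : (0 < m)%N by near: m; exists 1%N.
have m0' : 0 < m%:R :> R by rewrite ltr0n.
have Ce : 0 <= C / e by rewrite divr_ge0// ltW.
have : powR (C / e) k^-1 <= m%:R.
  rewrite (le_trans (ltW (truncnS_gt _)))// ler_nat; near: m.
  by exists (Num.truncn (powR (C / e) k^-1)).+1.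
move=> H; have : powR (powR (C / e) k^-1) k <= powR m%:R k.
  by apply: ge0_ler_powR; rewrite ?nnegrE ?powR_ge0// ltW.
rewrite -powRrM mulVf ?gt_eqF// powRr1// powRN => h.
by rewrite ler_pdivrMr ?powR_gt0// mulrC -ler_pdivrMr.
Unshelve. all: by end_near. Qed.

End BadEvents.

(** * Convergence in distribution at a continuity point *)

Unset Implicit Arguments.
Set Strict Implicit.

Theorem theorem2p1 (R : realType) (d p : nat) (hd : (0 < d)%N) (hp : (0 < p)%N)
  (xs : 'I_p -> 'cV[R]_d)
  (dT : measure_display) (T : measurableType dT) (P : probability T R)
  (X : nat -> T -> 'cV[R]_d)
  (hX : forall (i : nat) (l : 'I_d), measurable_fun setT (fun w => X i w l ord0))
  (* (a) *)
  (hstat : stationary P (Yvec xs X))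
  (Sigma : 'M[R]_p) (hlr : long_run_cov P (Yvec xs X) Sigma)
  (hSpd : posdef Sigma)
  (* Sigma^{1/2}: the symmetric positive-definite square root of Sigma *)
  (Shalf : 'M[R]_p) (hShalf_pd : posdef Shalf) (hShalf : Shalf *m Shalf = Sigma)
  (* (b) *)
  (W1 W2 : nat -> R -> T -> 'cV[R]_p)
  (hW1 : forall m, std_BM P (W1 m)) (hW2 : forall m, std_BM P (W2 m))
  (hW12 : forall m, indep_processes P (W1 m) (W2 m))
  (* (c) *)
  (xi : R) (hxi : 0 < xi < 1 / 2)
  (hc1 : bounded_in_prob P (fun m w =>
     ereal_sup [set ((powR (k - m)%:R xi)^-1 *
        norm2 (\sum_(m.+1 <= i < k.+1) (Yvec xs X i w - meanY P (Yvec xs X))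
               - Shalf *m W1 m (k - m)%:R w))%:E
       | k in [set k : nat | (m < k)%N]]))
  (hc2 : bounded_in_prob P (fun m w =>
     ((powR m%:R xi)^-1 *
        norm2 (\sum_(1 <= i < m.+1) (Yvec xs X i w - meanY P (Yvec xs X))
               - Shalf *m W2 m m%:R w))%:E))
  (* estimators Sigma_m *)
  (Sm : nat -> T -> 'M[R]_p)
  (hSm_est : forall m, exists f : ('I_m -> 'cV[R]_p) -> 'M[R]_p,
      forall w, Sm m w = f (fun i => Yvec xs X i.+1 w))
  (hSm_inv : forall m w, Sm m w \in unitmx)
  (hSm_cons : forall (a b : 'I_p) (eps : R), 0 < eps ->
      (fun m : nat => fine (P [set w | eps < `|Sm m w a b - Sigma a b|]))
        @ \oo --> 0)
  (eta : R) (heta : 0 < eta) :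
  forall (dT' : measure_display) (T' : measurableType dT')
         (P' : probability T' R) (W : R -> T' -> 'cV[R]_p),
  std_BM P' W ->
  (P' [set w | Lpeta W eta w = +oo%E] = 0%E) /\
  (forall x : R,
     {for x, continuous (fun y : R => fine (P' [set w | (Lpeta W eta w <= y%:E)%E]))} ->
     (fun m : nat =>
        fine (P [set w | (monitor_stat (Yvec xs X) Sm eta m w <= x%:E)%E]))
       @ \oo --> fine (P' [set w | (Lpeta W eta w <= x%:E)%E])).
Proof.
move=> dT' T' P' W BM; split; first exact: Lpeta_finite.
move=> x cF; set Y := Yvec xs X; set mu := meanY P Y.
(* For negative [x] both events are empty, as statistic and limit are nonnegative. *)
have [x0|x0] := ltP x 0.
  rewrite (_ : (fun m => _) = cst (fine (P' [set w | (Lpeta W eta w <= x%:E)%E])));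
    first exact: cvg_cst.
  apply/funext => m /=; rewrite (_ : [set w | _] = set0); last first.
    apply/seteqP; split => w //= H; have := le_trans (monitor_stat_ge0 _ _ _ _ _) H.
    by rewrite lee_fin leNgt x0.
  rewrite measure0 (_ : [set w | _] = set0) ?measure0//.
  apply/seteqP; split => w //= H; have := le_trans (Lpeta_ge0 _ _ w) H.
  by rewrite lee_fin leNgt x0.
pose Fm y m := fine (P' (grid_event eta m y (scaled_grid W m))).
apply: (@sandwich_cvg R (fun y => fine (P' [set w | (Lpeta W eta w <= y%:E)%E])) Fm _ x cF).
  (* The shift avoids m = 0, where the grid of mesh [1/m] degenerates. *)
  by move=> y; rewrite -cvg_shiftS; exact: cvg_grid_event_prob.
move=> e r dl e0 r01 dl0.
have [d0 d00 Hd0] := normM_inv_near hShalf_pd hShalf r01.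
have e3 : 0 < e / 3 by rewrite divr_gt0.
have [M1 HM1] := hc1 _ e3.
have [M2 HM2] := hc2 _ e3.
pose K := Num.max 0 (Num.max M1 M2).
have K0 : 0 <= K by rewrite le_max lexx.
have K1 : M1 <= K by rewrite !le_max lexx orbT.
have K2 : M2 <= K by rewrite !le_max lexx !orbT.
case/andP: (hxi) => xi0 xi1.
(* The third of [e] reserved for the estimator is shared among the entries of the matrix. *)
pose c : R := (e / 3) / (#|{: 'I_p * 'I_p}|%:R + 1).
have c0 : 0 < c by rewrite divr_gt0// ltr_wpDl.
pose E3 m := [set w | exists i : 'I_p * 'I_p, d0 < `|Sm m w i.1 i.2 - Sigma i.1 i.2|].
have mS m i : measurable [set w | d0 < `|Sm m w i.1 i.2 - Sigma i.1 i.2|].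
  apply: measurable_lt_cst; apply: (measurableT_comp (@normr_measurable R setT)).
  by apply: measurable_funB => //; exact: measurable_estimator.
have N3 : \forall m \near \oo, forall i : 'I_p * 'I_p,
    (P [set w | (d0 < `|Sm m w i.1 i.2 - Sigma i.1 i.2|)%R] <= c%:E)%E.
  apply: filter_forall => -[a b] /=.
  have /cvgrPdist_le /(_ _ c0) := hSm_cons a b d0 d00.
  apply: filterS => m; rewrite sub0r normrN => h.
  rewrite -[X in (X <= _)%E]fineK ?lee_fin; last by apply: fin_num_measure; exact: (mS m (a, b)).
  exact: le_trans (ler_norm _) h.
have N4 : \forall m \near \oo, sandwich_error xi Shalf m K <= dl.
  have := @powR_neg_small R (4 * frob (invmx Shalf) / Num.sqrt p%:R * K) (1 / 2 - xi) dl.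
  rewrite opprB; apply => //; last by lra.
  by rewrite mulr_ge0// divr_ge0 ?sqrtr_ge0// mulr_ge0// frob_ge0.
pose E1 m := [set w | (M1%:E < ereal_sup [set ((powR (k - m)%:R xi)^-1 *
        norm2 (\sum_(m.+1 <= i < k.+1) (Y i w - mu) - Shalf *m W1 m (k - m)%:R w))%:E
       | k in [set k : nat | (m < k)%N]])%E].
pose E2 m := [set w | (M2%:E < ((powR m%:R xi)^-1 *
        norm2 (\sum_(1 <= i < m.+1) (Y i w - mu) - Shalf *m W2 m m%:R w))%:E)%E].
have N1 : \forall m \near \oo, (P (E1 m) < (e / 3)%:E)%E by exact: HM1.
have N2 : \forall m \near \oo, (P (E2 m) < (e / 3)%:E)%E by exact: HM2.
near=> m.
have m0 : (0 < m)%N by near: m; exists 1%N.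
have mY := measurable_Yvec xs hX.
have [mW1 W10 _ _] := hW1 m; have [mW2 _ _ _] := hW2 m.
have mE1 : measurable (E1 m).
  apply: measurable_sup_gt => k; apply: measurable_funM => //.
  exact: measurable_residual.
have mE2 : measurable (E2 m).
  under [X in measurable X]eq_set do rewrite lte_fin.
  apply: measurable_lt_cst; apply: measurable_funM => //.
  exact: measurable_residual.
have mE3 : measurable (E3 m) by apply: measurable_exists_fin => i; exact: mS.
have PE1 : (P (E1 m) < (e / 3)%:E)%E by near: m.
have PE2 : (P (E2 m) < (e / 3)%:E)%E by near: m.
have PE3 : (P (E3 m) <= (e / 3)%:E)%E.
  rewrite (le_trans (@finite_union_bound _ _ _ P _ _ c (mS m) _))//; first by near: m.
  by rewrite lee_fin /c mulrA ler_pdivrMr ?ltr_wpDl// mulrC ler_wpM2l ?ltW// ltrDl.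
have mbad : measurable (E1 m `|` E2 m `|` E3 m) by apply: measurableU => //; exact: measurableU.
have Pbad : (P (E1 m `|` E2 m `|` E3 m) <= e%:E)%E.
  rewrite (le_trans (measureU2 _ (measurableU _ _ mE1 mE2) mE3))//.
  rewrite (_ : e = e / 3 + e / 3 + e / 3); last by lra.
  rewrite !EFinD leeD// (le_trans (measureU2 _ mE1 mE2))// leeD// ltW//.
have errd : sandwich_error xi Shalf m K <= dl by near: m.
have good w : ~ (E1 m `|` E2 m `|` E3 m) w -> forall j k, (j < k)%N ->
   (1 - r) * (grid_term eta m (m + j) (m + k) (glued (W1 m) (W2 m) m w j) (glued (W1 m) (W2 m) m w k) - dl) <=
    stat_term eta Y (Sm m w) m (m + j) (m + k) w <=
   (1 + r) * (grid_term eta m (m + j) (m + k) (glued (W1 m) (W2 m) m w j) (glued (W1 m) (W2 m) m w k) + dl).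
  move=> nbad j k jk.
  have b1 l : (m < l)%N ->
      norm2 (\sum_(m.+1 <= i < l.+1) (Y i w - mu) - Shalf *m W1 m (l - m)%:R w) <=
      K * powR (l - m)%:R xi.
    move=> ml; have lm0 : 0 < powR (l - m)%:R xi :> R by rewrite powR_gt0// ltr0n subn_gt0.
    rewrite -ler_pdivrMr// mulrC (le_trans _ K1)// leNgt; apply/negP => h.
    apply: nbad; left; left; rewrite /E1 /= -lte_fin in h *; apply: (lt_le_trans h).
    by apply: ereal_sup_ubound; exists l.
  have b2 : norm2 (\sum_(1 <= i < m.+1) (Y i w - mu) - Shalf *m W2 m m%:R w) <=
      K * powR m%:R xi.
    have pm0 : 0 < powR m%:R xi :> R by rewrite powR_gt0// ltr0n.
    rewrite -ler_pdivrMr// mulrC (le_trans _ K2)// leNgt; apply/negP => h.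
    by apply: nbad; left; right; rewrite /E2 /= lte_fin.
  have b3 := Hd0 (Sm m w) (hSm_inv m w).
  have {}b3 : forall u, (1 - r) * normM 1%:M u <= normM (invmx (Sm m w)) (Shalf *m u)
              <= (1 + r) * normM 1%:M u.
    apply: b3 => a b; rewrite leNgt; apply/negP => h.
    by apply: nbad; right; exists (a, b).
  have := stat_term_sandwich heta hxi (posdef_unitmx hShalf_pd) m0 K0 (W10 w) b1 b2 jk r01 b3.
  case/andP: r01 => r0 r1 /andP[s1 s2]; apply/andP; split.
    by apply: le_trans s1; rewrite ler_wpM2l ?lerB// subr_ge0 ltW.
  by apply: (le_trans s2); rewrite ler_wpM2l ?lerD// addr_ge0// ltW.
have mG y : measurable (grid_event eta m y (fun j w => glued (W1 m) (W2 m) m w j)).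
  apply: measurable_grid_event => j a; under eq_fun do rewrite mxE.
  exact: measurable_funD.
have mstat : measurable [set w | (monitor_stat Y Sm eta m w <= x%:E)%E].
  rewrite (_ : [set _ | _] = [set w | forall j, [set w | forall k, [set w |
     (m <= j < k)%N -> [set w | stat_term eta Y (Sm m w) m j k w <= x] w] w] w]).
    apply: measurable_forall_nat => j; apply: measurable_forall_nat => k.
    apply: measurable_imply => mjk; apply: measurable_le_cst.
    exact: measurable_stat_term.
  by apply/seteqP; split => w /=; [move/(monitor_stat_leP _ _ _ _ m0 x0)|move=> h; apply/(monitor_stat_leP _ _ _ _ m0 x0)].
have r1p : 0 < 1 + r by case/andP: r01 => r0 _; rewrite addr_gt0.
have r1m : 0 < 1 - r by case/andP: r01 => _ r1; rewrite subr_gt0.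
(* The Gaussian probabilities move from [P'] to [P], where they can be compared with the data
   outcome by outcome. *)
have FmE y : Fm y m = fine (P (grid_event eta m y (fun j w => glued (W1 m) (W2 m) m w j))).
  by rewrite /Fm (glued_grid_law eta y (hW1 m) (hW2 m) (hW12 m) BM m0).
(* Off the exceptional event, a statistic at most [x] puts the grid terms below [x / (1 - r) + dl],
   and grid terms at most [x / (1 + r) - dl] put the statistic below [x]. *)
rewrite !FmE; split; apply: (fine_prob_le_union _ _ mbad) => //.
  move=> w /= /(monitor_stat_leP _ _ _ _ m0 x0) h.
  have [bad|nbad] := pselect ((E1 m `|` E2 m `|` E3 m) w); [by right|left].
  move=> j k jk; have /andP[g1 _] := good w nbad j k jk.
  have := le_trans g1 (h (m + j)%N (m + k)%N _).
  rewrite leq_addr ltn_add2l => /(_ jk).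
  by rewrite mulrC -ler_pdivlMr// lerBlDr.
move=> w /= h.
have [bad|nbad] := pselect ((E1 m `|` E2 m `|` E3 m) w); [by right|left].
apply/(monitor_stat_leP _ _ _ _ m0 x0) => j k /andP[mj jk].
have mk : (m <= k)%N := leq_trans mj (ltnW jk).
have jk' : (j - m < k - m)%N by rewrite ltn_sub2r// (leq_ltn_trans mj).
have /andP[_ g2] := good w nbad _ _ jk'; have := h _ _ jk'.
rewrite !subnKC// in g2 * => h'; apply: (le_trans g2).
by rewrite mulrC -ler_pdivlMr// -lerBrDr.
Unshelve. all: by end_near. Qed.
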